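(* Let $(S(t,s;\omega))_{t\ge s,\ \omega\in\Omega}$ be a white noise stochastic flow on the Polish space $X$ over the probability space $(\Omega,\mathscr{F},\mathbb{P})$, with associated transition operators $\{P_{st}\}_{s\le t}$. Then the following hold. (a) Let $\{\rho_s\}_{s\in\mathbb{R}}$ be an evolution system of measures for $\{P_{st}\}$. Then for every $t\in\mathbb{R}$ the limit $$\lim_{s\to-\infty} S(t,s;\omega)\rho_s=\mu_{t\omega}$$ exists in the sense of weak convergence of probability measures on $X$, almost surely along each deterministic sequence $\{s\}$ converging to $-\infty$ (the limit $\mu_{t\omega}$ being, up to $\mathbb{P}$-null sets, the same for all such sequences), and: (i) $\{\mu_t\}_{t\in\mathbb{R}}$ is an evolution system of measures for $S$, where $\mu_t$ is the probability measure on $\Omega\times X$ with marginal $\mathbb{P}$ on $\Omega$ and disintegration $\omega\mapsto\mu_{t\omega}$; (ii) $\omega\mapsto\mu_{t\omega}$ is measurable with respect to $\mathcal{F}_{\le t}$ for each $t\in\mathbb{R}$; (iii) $\mathbb{E}(\mu_{t\omega}(B))=\rho_t(B)$ for all $t\in\mathbb{R}$ and $B\in\mathscr{B}(X)$. (b) If $\{\mu_t\}_{t\in\mathbb{R}}$ is an evolution system of measures for $S$ such that $\mu_t$ is $\mathcal{F}_{\le t}$-measurable for each $t\in\mathbb{R}$ (that is, its disintegration $\omega\mapsto\mu_{t\omega}$ is $\mathcal{F}_{\le t}$-measurable), then $$\rho_t(B)=\int_\Omega \mu_{t\omega}(B)\,d\mathbb{P}(\omega),\qquad t\in\mathbb{R},\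 B\in\mathscr{B}(X),$$ defines an evolution system of measures for $\{P_{st}\}$.
   Context: $(\Omega,\mathscr{F},\mathbb{P})$ is a probability space, $(X,d)$ a Polish (complete separable metric) space with Borel $\sigma$-algebra $\mathscr{B}(X)$. Stochastic flow: a family of maps $S(t,s;\omega):X\to X$, $-\infty<s\le t<\infty$, $\omega\in\Omega$, such that for $\mathbb{P}$-a.e. $\omega$: (i) $S(t,r;\omega)S(r,s;\omega)=S(t,s;\omega)$ for all $s\le r\le t$; (ii) $x\mapsto S(t,s;\omega)x$ is continuous for all $s\le t$; (iii) for all $t\in\mathbb{R}$, $x\in X$ the mapping $(s,\omega)\mapsto S(t,s;\omega)x$ is measurable from $((-\infty,t]\times\Omega,\mathscr{B}((-\infty,t])\otimes\mathscr{F})$ to $(X,\mathscr{B}(X))$; (iv) $S(t,t;\omega)=\mathrm{id}_X$ for all $t\in\mathbb{R}$. No continuity in the time variables is assumed. For $s\in\mathbb{R}$ let $\mathcal{F}_{\ge s}=\overline{\sigma\{S(u,t;\cdot)x : s\le t\le u,\ x\in X\}}$ and $\mathcal{F}_{\le s}=\overline{\sigma\{S(u,t;\cdot)x : t\le u\le s,\ x\in X\}}$, the bar denoting completion with respect to $\mathbb{P}$. The flow is a white noise stochastic flow if $\mathcal{F}_{\ge s}$ and $\mathcal{F}_{\le s}$ are independent for each $s\in\mathbb{R}$. For a white noise stochastic flow, the associated (inhomogeneous) Markov semigroup of transition operators is $P_{st}f(x):=\mathbb{E}(f(S(t,s;\omega)x))$ for $s\le t$ and $f:X\to\mathbb{R}$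 bounded measurable. For a Borel probability measure $\rho$ on $X$, $P_{st}\rho$ denotes the image of $\rho$ under $P_{st}$, i.e. $(P_{st}\rho)(B)=\int_X P_{st}1_B\,d\rho$ for $B\in\mathscr{B}(X)$. An evolution system of measures for $\{P_{st}\}$ is a family $\{\rho_s\}_{s\in\mathbb{R}}$ of Borel probability measures on $X$ with $P_{st}\rho_s=\rho_t$ for all $s\le t$. For fixed $\omega$, $S(t,s;\omega)\rho$ denotes the image of the measure $\rho$ on $X$ under the map $x\mapsto S(t,s;\omega)x$. A probability measure $\mu$ on $(\Omega\times X,\mathscr{F}\otimes\mathscr{B}(X))$ with marginal $\mathbb{P}$ on $\Omega$ has a disintegration $\mu_\omega$: each $\mu_\omega$ is a Borel probability measure on $X$, $\omega\mapsto\mu_\omega(B)$ is measurable for all $B\in\mathscr{B}(X)$, and $\mu(A\times B)=\int 1_A\,\mu_\omega(B)\,d\mathbb{P}(\omega)$ for $A\in\mathscr{F}$, $B\in\mathscr{B}(X)$. The disintegration of $\mu_t$ is written $\mu_{t\omega}$. It is $\mathcal{G}$-measurable if $\omega\mapsto\mu_{t\omega}(B)$ is $\mathcal{G}$-measurable for every $B\in\mathscr{B}(X)$. An evolution system of measures for the stochastic flow $S$ is a family $\{\mu_s\}_{s\in\mathbb{R}}$ of probability measures on $(\Omega\times X,\mathscr{F}\otimes\mathscr{B}(X))$, each with marginal $\mathbb{P}$ on $\Omega$, such that $S(t,s;\cdot)\mu_s=\mu_t$ for all $s\le t$, where $S(t,s;\cdot)\mu_s$ is the image of $\mu_s$ under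 the map $(\omega,x)\mapsto(\omega,S(t,s;\omega)x)$. *)

(* Defs.v *)
From HB Require Import structures.
From mathcomp Require Import all_boot all_order all_algebra.
From mathcomp Require Import all_classical all_reals all_analysis.
From mathcomp Require Import measurable_realfun.

Set Implicit Arguments.
Unset Strict Implicit.
Unset Printing Implicit Defensive.

Import Order.TTheory GRing.Theory Num.Theory.
Import numFieldNormedType.Exports.

Local Open Scope classical_set_scope.
Local Open Scope ring_scope.

(* Completeness comes with a base point in the library, so the carrier is
   nonempty; this is implied by the existence of a probability measure on it. *)
#[short(type="completeMetricType")]
HB.structure Definition CompleteMetric (R : numDomainType) :=
  {T of CompletePseudoMetric R T & Metric R T}.

Definition separable (T : topologicalType) : Prop :=
  exists2 D : set T, countable D & dense D.

Definition borel (R : realType) (X : completeMetricType R) : measurableType _ :=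
  g_sigma_algebraType (@open X).

Section sigma_algebras.
Context {R : realType} {d : measure_display} {Omega : measurableType d}.
Variable P : probability Omega R.

(* The augmentation of G by all P-null sets of the ambient sigma-algebra and
   their subsets. The negligible part is a symmetric difference: sets of the
   form [A `|` N] would not be closed under complement when G is a proper
   sub-sigma-algebra. *)
Definition completion (G : set (set Omega)) : set (set Omega) :=
  [set A | exists2 B, G B & P.-negligible (A `+` B)].

(* Events of a completed sigma-algebra need not be measurable for the original
   one, so their probability is that of the completion of P, which is the
   restriction of the outer measure of P. *)
Definition independent_sigma (G H : set (set Omega)) : Prop :=
  forall A B, G A -> H B ->
    ((P^*)%mu (A `&` B) = (P^*)%mu A * (P^*)%mu B)%E.

Definition measurable_wrt (G : set (set Omega)) (f : Omega -> \bar R) : Prop :=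
  forall Y : set (\bar R), measurable Y -> G (f @^-1` Y).

End sigma_algebras.

(* The nu n are set functions because the image of a measure
   under a non-measurable map is not a measure. *)
Definition weak_cvg (R : realType) (X : completeMetricType R)
    (nu : nat -> set (borel X) -> \bar R) (mu : probability (borel X) R) : Prop :=
  forall f : X -> R, continuous f -> (exists M : R, forall x, `|f x| <= M) ->
    (\int[nu n]_x (f x)%:E)%E @[n --> \oo] --> (\int[mu]_x (f x)%:E)%E.

Section flow.
Context {R : realType} {d : measure_display} {Omega : measurableType d}.
Variable P : probability Omega R.
Context {X : completeMetricType R}.

(* [S t s w] stands for S(t,s;w); its values for t < s are irrelevant. *)
Variable S : R -> R -> Omega -> X -> X.

Record stochastic_flow : Prop := {
  flow_pathwise : {ae P, forall w,
    [/\ forall s r t, s <= r -> r <= t -> S t r w \o S r s w = S t s w,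
        forall s t, s <= t -> continuous (S t s w) &
        forall t, S t t w = id] };
  flow_measurable : forall (t : R) (x : X),
    measurable_fun (`]-oo, t] `*` [set: Omega] : set (R * Omega))
      (fun p : R * Omega => S t p.1 p.2 x : borel X)
}.

Definition sigma_ge (s : R) : set (set Omega) :=
  completion P <<s [set A | exists u t (x : X) (B : set (borel X)),
    [/\ s <= t, t <= u, measurable B & A = (fun w => S u t w x) @^-1` B]] >>.

Definition sigma_le (s : R) : set (set Omega) :=
  completion P <<s [set A | exists u t (x : X) (B : set (borel X)),
    [/\ t <= u, u <= s, measurable B & A = (fun w => S u t w x) @^-1` B]] >>.

Definition white_noise_flow : Prop :=
  stochastic_flow /\ forall s, independent_sigma P (sigma_ge s) (sigma_le s).

Definition transition (s t : R) (f : X -> R) (x : X) : \bar R :=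
  'E_P[fun w => f (S t s w x)]%E.

Definition evolution_system_semigroup (rho : R -> probability (borel X) R) :
    Prop :=
  forall s t, s <= t -> forall B : set (borel X), measurable B ->
    (\int[rho s]_x transition s t \1_B x)%E = rho t B.

Definition marginal (mu : probability (Omega * borel X)%type R) : Prop :=
  forall A : set Omega, measurable A -> pushforward mu fst A = P A.

Definition skew (s t : R) (p : Omega * borel X) : Omega * borel X :=
  (p.1, S t s p.1 p.2).

(* [skew s t] is jointly measurable only up to a null set of w's, so the image
   is taken for the completion of [mu s]. *)
Definition evolution_system_flow
    (mu : R -> probability (Omega * borel X)%type R) : Prop :=
  (forall s, marginal (mu s)) /\
  forall s t, s <= t -> forall C : set (Omega * borel X), measurable C ->
    pushforward ((mu s)^*)%mu (skew s t) C = mu t C.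

Definition disintegration (mu : probability (Omega * borel X)%type R)
    (mu_ : Omega -> probability (borel X) R) : Prop :=
  (forall B, measurable B -> measurable_fun [set: Omega] (fun w => mu_ w B)) /\
  forall A B, measurable A -> measurable B ->
    mu (A `*` B) = (\int[P]_w ((\1_A w)%:E * mu_ w B))%E.

End flow.

(* Main.v *)
From HB Require Import structures.
Require Import Defs.
From mathcomp Require Import all_boot all_order all_algebra.
From mathcomp Require Import all_classical all_reals all_analysis.
From mathcomp Require Import measurable_realfun.
From mathcomp Require Import ring lra.

(** The proof of part (a) follows, for a fixed time t and a Borel set B, the random
    mass rho_s {x : S(t,s,w)x in B} as s decreases to minus infinity. For r <= s the
    map S(t,r) is S(t,s) after S(s,r), where S(s,r) is independent of everything that
    happens after s; averaging over it turns rho_r into rho_s. Hence the conditional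
    expectation of the mass at r given the future of s is the mass at s
    ([mass_martingale]): the masses form a bounded reversed martingale. It converges
    almost surely along every sequence of times tending to minus infinity, with a
    limit that does not depend on the sequence ([mass_cvg2], from Kolmogorov's
    maximal inequality [reversed_martingale_maximal] and an interleaving).

    Convergence of masses has to be upgraded to weak convergence of measures. The
    space is cut by a dense sequence into a countable tree of Borel cylinders, the
    cylinders of generation k having diameter of order 1/k. Almost surely the masses
    of all cylinders converge, and the limits are consistent: the limits of the
    children sum up to at most the limit of the parent, and the expectations of the
    two sides agree because they are values of the measure rho_t
    ([ae_proper_limit]). A consistent family of masses is the law of a random point:
    a uniform number selects an infinite branch of the tree with the prescribed
    probabilities ([node_law]), and by completeness the branch converges to a point
    ([coded]). Comparing a bounded continuous function with its infima over the
    cylinders of one generation shows that the convergence of the masses of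
    cylinders to consistent limits implies weak convergence to the law of this point
    ([coded_law_weak_cvg]).

    The remaining claims follow. The limit masses are upper limits of variables
    measurable with respect to the past of t. The mean of the limit law is rho_t by
    bounded convergence ([expectation_limit_law]). As S(t,s,w) is continuous and
    S(t,r) = S(t,s) S(s,r), uniqueness of weak limits shows that S(t,s,w) maps the
    limit law at s to the limit law at t ([limit_law_flow]).

    For part (b), mu_(s,w) depends on the past of s and S(t,s,w) on its future.
    Restricted to the future of s in the first coordinate, mu_s is therefore the
    product of P and its mean rho_s, and the image of this product under the flow
    has mean P_st rho_s ([mixing_evolution]).

    All this is carried out for a flow satisfying its axioms for every w; the given
    flow is reduced to this case by modifying it on a null set ([perfect_flow_of]). *)

Set Implicit Arguments.
Unset Strict Implicit.
Unset Printing Implicit Defensive.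

Import Order.TTheory GRing.Theory Num.Theory.
Import numFieldNormedType.Exports.

Local Open Scope classical_set_scope.
Local Open Scope ring_scope.

(** * Laws, independence and completion *)

Lemma measurable_preimageT d d' (T : measurableType d) (T' : measurableType d')
    (f : T -> T') B :
  measurable_fun setT f -> measurable B -> measurable (f @^-1` B).
Proof. by move=> mf mB; rewrite -[f @^-1` B]setTI; exact: mf. Qed.

Section image_law.
Context d d' (T : measurableType d) (T' : measurableType d') (R : realType).
Variables (P : probability T R) (f : T -> T').
Hypothesis mf : measurable_fun setT f.

Let f_mixin := isMeasurableFun.Build _ _ _ _ _ mf.
Let f_mfun : {mfun T >-> T'} := HB.pack f f_mixin.

(** The pushforward of a probability, bundled again as a probability so that it
    can be used where only measures with their structure are accepted. *)
Definition image_law : probability T' R := distribution P f_mfun.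

Lemma image_lawE A : image_law A = P (f @^-1` A). Proof. by []. Qed.

Lemma ge0_integral_image_law (h : T' -> \bar R) :
  measurable_fun setT h -> (forall y, 0 <= h y)%E ->
  (\int[image_law]_y h y = \int[P]_x h (f x))%E.
Proof. by move=> mh h0; rewrite ge0_integral_pushforward. Qed.

End image_law.

Section independence.
Local Open Scope ereal_scope.
Context d d1 d2 (T : measurableType d) (T1 : measurableType d1)
  (T2 : measurableType d2) (R : realType).
Variables (P : probability T R) (X : T -> T1) (Y : T -> T2).
Hypotheses (mX : measurable_fun setT X) (mY : measurable_fun setT Y).
Hypothesis indep : forall A B, measurable A -> measurable B ->
  P (X @^-1` A `&` Y @^-1` B) = P (X @^-1` A) * P (Y @^-1` B).

(** Independence says that the joint law of [X] and [Y] is the product of their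
    laws; the iterated integral is then Tonelli's theorem. Used with [X] and [Y]
    both the identity of the sample space, but with the future and the past
    sigma-algebra on the target, it decouples the two occurrences of [w]. *)
Lemma independent_integral (h : T1 * T2 -> \bar R) :
  measurable_fun setT h -> (forall z, 0 <= h z) ->
  \int[P]_w h (X w, Y w) = \int[P]_w \int[P]_w' h (X w, Y w').
Proof.
move=> mh h0; have mXY := measurable_fun_pair mX mY.
rewrite -(ge0_integral_image_law P mXY)//.
rewrite (eq_measure_integral (image_law P mX \x image_law P mY)); last first.
  move=> A mA _; symmetry.
  by apply: product_measure_unique => //= B C mB mC; exact: indep.
rewrite fubini_tonelli1// ge0_integral_image_law//=.
- apply: eq_integral => w _; rewrite /fubini_F ge0_integral_image_law//.
  exact: measurableT_comp.
- exact: measurable_fun_fubini_tonelli_F.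
- by move=> w; apply: integral_ge0 => w' _.
Qed.

End independence.

Section sub_sigma_algebra.
Context d (T : measurableType d) (R : realType) (P : probability T R).
Implicit Types (G : set (set T)).

Lemma sigma_algebra_completion G : sigma_algebra setT G -> G `<=` measurable ->
  sigma_algebra setT (completion P G).
Proof.
move=> sG GM; split.
- exists set0; first by case: sG.
  by rewrite setYK; exact: negligible_set0.
- move=> A [B GB nAB]; exists (~` B); first by case: sG => _ + _; rewrite -setTD; exact.
  rewrite (_ : _ `+` _ = A `+` B)//.
  by rewrite !setY_def setTD !setDE !setCK setUC ![~` _ `&` _]setIC.
- move=> F cF; have /choice[B GB] : forall n, exists B, G B /\ P.-negligible (F n `+` B).
    by move=> n; have [B ? ?] := cF n; exists B.
  exists (\bigcup_n B n).
    by case: sG => _ _; apply => n; have [] := GB n.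
  apply: (negligibleS _ (negligible_bigcup (fun n => (GB n).2))).
  rewrite !setY_def => x [[[n _ Fx] nBx]|[[n _ Bx] nFx]]; exists n => //; rewrite setY_def.
    by left; split => // Bx; apply: nBx; exists n.
  by right; split => // Fx; apply: nFx; exists n.
Qed.

Lemma sigma_algebraI G : sigma_algebra setT G -> sigma_algebra setT (G `&` measurable).
Proof.
move=> [G0 GC GU]; split.
- by split.
- by move=> A [GA mA]; split; [exact: GC|exact: measurableD].
- by move=> F GF; split; [apply: GU|apply: bigcupT_measurable] => n; have [] := GF n.
Qed.

End sub_sigma_algebra.

(** * Borel maps into a separable complete metric space *)

Section metric_space.
Context {R : realType} {X : completeMetricType R}.
Implicit Types (x y : X).

Lemma lipschitz_continuous (f : X -> R) :
  (forall x y, `|f x - f y| <= mdist x y) -> continuous f.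
Proof.
move=> lf x; apply/cvgrPdist_lt => e e0.
have : nbhs x (ball x e) by exact: nbhsx_ballx.
apply: filterS => y; rewrite ballEmdist/=; exact: le_lt_trans.
Qed.

Lemma mdist_continuous (a : X) : continuous (fun x => mdist x a : R).
Proof.
apply: lipschitz_continuous => x y; rewrite ler_norml; apply/andP; split.
- by have := metric_triangle y x a; rewrite (metric_sym y x); lra.
- by have := metric_triangle x y a; lra.
Qed.

Lemma open_mdist_lt (a : X) (e : R) : open [set x : X | mdist x a < e].
Proof.
have /continuousP/(_ _ (@open_lt _ e)) := @mdist_continuous a.
by [].
Qed.

Lemma measurable_open_borel (U : set X) : open U -> measurable (U : set (borel X)).
Proof. exact: sub_sigma_algebra. Qed.

Lemma open_exists_mdist (U : set X) x : open U -> U x ->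
  exists2 e : R, 0 < e & forall y, mdist x y < e -> U y.
Proof.
move=> oU Ux; have : nbhs x U by exact: open_nbhs_nbhs.
by rewrite -nbhs_ballE => -[e /= e0 xeU]; exists e => // y xy; apply: xeU; rewrite ballEmdist.
Qed.

Lemma measurable_fun_borel d (T : measurableType d) (f : T -> X) :
  (forall U, open U -> measurable (f @^-1` U)) ->
  measurable_fun setT (f : T -> borel X).
Proof.
move=> mf; apply: (@measurability _ _ T (borel X) setT f (@open X) erefl).
by move=> _ [U oU <-]; rewrite setTI; exact: mf.
Qed.

Lemma continuous_measurable_borel (f : X -> R) :
  continuous f -> measurable_fun setT (f : borel X -> R).
Proof.
move=> /continuousP cf.
apply: (measurability (@RGenOpens.G R)); first exact: RGenOpens.measurableE.
move=> _ [_ [a [b ->]] <-]; rewrite setTI.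
by apply: measurable_open_borel; apply: cf; exact: interval_open.
Qed.

Lemma continuous_measurable_borel_map (f : X -> X) :
  continuous f -> measurable_fun setT (f : borel X -> borel X).
Proof.
move=> /continuousP cf; apply: measurable_fun_borel => U oU.
by apply: measurable_open_borel; exact: cf.
Qed.

(** If [K k] denotes the points all of whose neighbours at distance less than
    1/(k+1) belong to [U], the limit lies in an open [U] exactly when for some
    [k] the sequence is eventually in [K k]; each [K k] is closed. *)
Lemma measurable_lim_borel d (T : measurableType d) (f_ : nat -> T -> X) (f : T -> X) :
  (forall n, measurable_fun setT (f_ n : T -> borel X)) ->
  (forall w, f_ n w @[n --> \oo] --> f w) ->
  measurable_fun setT (f : T -> borel X).
Proof.
move=> mf_ f_f; apply: measurable_fun_borel => U oU.
pose K k := [set y : X | forall z, mdist y z < k.+1%:R^-1 -> U z].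
have mK k : measurable (K k : set (borel X)).
  rewrite -[K k]setCK; apply: measurableC; apply: measurable_open_borel.
  rewrite (_ : ~` _ = \bigcup_(z in ~` U) [set y : X | mdist y z < k.+1%:R^-1]).
    by apply: bigcup_open => z _; exact: open_mdist_lt.
  apply/seteqP; split => y /=.
    by move=> /existsNP[z /not_implyP[yz nUz]]; exists z.
  by move=> [z nUz yz] Ky; apply: nUz; exact: Ky.
rewrite (_ : f @^-1` U =
    \bigcup_k \bigcup_N \bigcap_(n in [set n | (N <= n)%N]) f_ n @^-1` K k).
  apply: bigcupT_measurable => k; apply: bigcupT_measurable => N.
  by apply: bigcap_measurableType => n _; exact: measurable_preimageT (mK k).
apply/seteqP; split => w /=.
- move=> Ufw; have [e e0 feU] := open_exists_mdist oU Ufw.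
  have e20 : 0 < e / 2 by rewrite divr_gt0.
  have [k] := ltr_add_invr e20; rewrite add0r => ke.
  have /metricType_numDomainType.cvgrPdist_lt/(_ _ e20)[N _ Nf] := f_f w.
  exists k => //; exists N => // n Nn z /= fnz; apply: feU.
  apply: (le_lt_trans (metric_triangle _ (f_ n w) _)).
  by rewrite (splitr e) ltrD//; [exact: Nf|exact: lt_trans ke].
- move=> [k _ [N _ KN]].
  have k0 : 0 < k.+1%:R^-1 :> R by rewrite invr_gt0.
  have /metricType_numDomainType.cvgrPdist_lt/(_ _ k0)[M _ Mf] := f_f w.
  have /= := Mf (maxn N M) (leq_maxr _ _).
  by rewrite metric_sym; apply: (KN (maxn N M)); exact: leq_maxl.
Qed.
End metric_space.

Lemma bounded_convergence d (T : measurableType d) (R : realType)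
    (m : probability T R) (f_ : nat -> T -> R) (f : T -> R) (M : R) :
  (forall n, measurable_fun setT (f_ n)) -> measurable_fun setT f ->
  (forall n x, `|f_ n x| <= M) ->
  {ae m, forall x, f_ n x @[n --> \oo] --> f x} ->
  (\int[m]_x (f_ n x)%:E @[n --> \oo] --> \int[m]_x (f x)%:E)%E.
Proof.
move=> mf_ mf fM f_f.
have [|||||_ _ //] := @dominated_convergence _ T R m setT measurableT
    (fun n x => (f_ n x)%:E) (EFin \o f) (EFin \o cst M).
- by move=> n; exact/measurable_EFinP.
- exact/measurable_EFinP.
- by apply: filterS f_f => x fx _; apply: cvg_EFin fx; exact: nearW.
- exact: finite_measure_integrable_cst.
- by apply: aeW => x n _; rewrite lee_fin.
Qed.

Lemma measurable_fun_countable d d' (T : measurableType d)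
    (T' : measurableType d') (C : countType) (g : T -> C) (h : C -> T') :
  (forall c, measurable (g @^-1` [set c])) ->
  measurable_fun setT (fun x => h (g x)).
Proof.
move=> mg _ B _; rewrite setTI.
rewrite (_ : _ @^-1` _ = \bigcup_(c in [set c | B (h c)]) g @^-1` [set c]).
  rewrite bigcup_mkcond; apply: countable_bigcupT_measurable => // c.
  by case: ifP.
by apply/seteqP; split => [x Bx|x [c Bc /= ->]//]; exists (g x).
Qed.

Lemma measurable_fun_select d d' (T : measurableType d) (T' : measurableType d')
    (g : T -> nat) (h : nat -> T -> T') :
  measurable_fun setT g -> (forall n, measurable_fun setT (h n)) ->
  measurable_fun setT (fun x => h (g x) x).
Proof.
move=> mg mh _ B mB; rewrite setTI.
rewrite (_ : _ @^-1` _ = \bigcup_n (g @^-1` [set n] `&` h n @^-1` B)).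
  by apply: bigcupT_measurable => n; apply: measurableI; exact: measurable_preimageT.
by apply/seteqP; split => [x Bx|x [n _ [/= ->]]//]; exists (g x).
Qed.

Lemma separable_seq (R : realType) (X : completeMetricType R) : separable X ->
  exists e : nat -> X, forall x (r : R), 0 < r -> exists n, mdist x (e n) < r.
Proof.
move=> [D cD dD].
have /pfcard_geP[D0|[e]] := cD.
  have [|x []] := dD setT _ openT; first by exists point.
  by rewrite D0.
exists e => x r r0.
have [||y [/= yr Dy]] := dD [set y : X | mdist y x < r].
- by exists x; rewrite /= mdistxx.
- exact: open_mdist_lt.
have [n _ eny] := 'surj_e Dy.
by exists n; rewrite eny metric_sym.
Qed.

Section centers.
Context {R : realType} {X : completeMetricType R}.
Variable e : nat -> X.
Hypothesis dense_e : forall x (r : R), 0 < r -> exists n, mdist x (e n) < r.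

Lemma near_center k x : exists n, mdist x (e n) < k.+1%:R^-1.
Proof. exact: dense_e. Qed.

(** The least index, in the dense sequence, of a point at distance less than
    1/(k+1) from [x]: taking the least one makes the choice measurable. *)
Definition center k x : nat := ex_minn (near_center k x).

Lemma center_lt k x : mdist x (e (center k x)) < k.+1%:R^-1.
Proof. by rewrite /center; case: ex_minnP. Qed.

Lemma measurable_center k : measurable_fun setT (center k : borel X -> nat).
Proof.
apply: (@measurable_fun_countable _ _ (borel X) nat nat (center k) id) => n.
pose B m := [set x : X | mdist x (e m) < k.+1%:R^-1].
have mB m : measurable (B m : set (borel X)).
  by apply: measurable_open_borel; exact: open_mdist_lt.
rewrite (_ : _ @^-1` _ = B n `&` \bigcap_(m in [set m | (m < n)%N]) ~` B m).
  apply: measurableI => //.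
  by apply: bigcap_measurableType => m _; exact: measurableC.
apply/seteqP; split => x /=.
- rewrite /center; case: ex_minnP => m xm minm <-; split => // l /= lm Bl.
  by have := minm _ Bl; rewrite leqNgt lm.
- move=> [Bn nB]; rewrite /center; case: ex_minnP => m xm minm.
  apply/eqP; rewrite eqn_leq minm//= leqNgt; apply/negP => /nB; exact.
Qed.

Lemma cvg_center x : e (center k x) @[k --> \oo] --> x.
Proof.
apply/metricType_numDomainType.cvgrPdist_lt => r r0.
have [k] := ltr_add_invr r0; rewrite add0r => kr.
exists k => // m km /=; apply: lt_trans (center_lt _ _) _.
by apply: le_lt_trans kr; rewrite lef_pV2 ?posrE// ler_nat.
Qed.

(** [f w x] is the limit of [f w] at the centres of [x], by continuity in [x];
    each approximant only takes countably many values in its second argument. *)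
Lemma caratheodory_measurable d (T : measurableType d) (f : T -> X -> X) :
  (forall x, measurable_fun setT (f ^~ x : T -> borel X)) ->
  (forall w, continuous (f w)) ->
  measurable_fun setT (fun p : T * borel X => f p.1 p.2 : borel X).
Proof.
move=> mf cf.
apply: (@measurable_lim_borel R X _ (T * borel X)%type
  (fun k p => f p.1 (e (center k p.2)))) => [k|p].
  apply: (@measurable_fun_select _ _ (T * borel X)%type (borel X)
    (fun p => center k p.2) (fun n p => f p.1 (e n))) => [|n].
    by apply: measurableT_comp; [exact: measurable_center|exact: measurable_snd].
  by apply: (measurableT_comp (mf (e n))); exact: measurable_fst.
have cfc (x : X) : f p.1 (e (center k x)) @[k --> \oo] --> f p.1 x.
  by apply: cvg_comp; [exact: cvg_center|exact: cf].
exact: cfc.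
Qed.

End centers.

Section measure_determination.
Context {R : realType} {X : completeMetricType R}.

Definition infdist (A : set X) (x : X) : R := inf [set mdist x a | a in A].

Let infdist_lb (A : set X) x : has_lbound [set mdist x a | a in A].
Proof. by exists 0 => _ [a _ <-]; exact: mdist_ge0. Qed.

Lemma infdist_le (A : set X) x a : A a -> infdist A x <= mdist x a.
Proof. by move=> Aa; apply: ge_inf => //; exists a. Qed.

Lemma infdist_ge (A : set X) x r : A !=set0 ->
  (forall a, A a -> r <= mdist x a) -> r <= infdist A x.
Proof.
move=> [a Aa] rA; apply: lb_le_inf; first by exists (mdist x a), a.
by move=> _ [b Ab <-]; exact: rA.
Qed.

Lemma infdist_continuous (A : set X) : A !=set0 -> continuous (infdist A).
Proof.
move=> A0; apply: lipschitz_continuous.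
have lip x y : infdist A x - infdist A y <= mdist x y.
  rewrite lerBlDr -lerBlDl; apply: infdist_ge => // a Aa.
  by rewrite lerBlDl (le_trans (infdist_le _ Aa))// metric_triangle.
by move=> x y; rewrite ler_norml lip andbT lerNl opprB metric_sym lip.
Qed.

Lemma infdist_gt0 (U : set X) x : open U -> ~` U !=set0 ->
  (0 < infdist (~` U) x) = (x \in U).
Proof.
move=> oU U0; apply/idP/idP => [d0|].
  rewrite inE; apply: contrapT => nUx; move: d0.
  by rewrite ltNge => /negP; apply; rewrite -(mdistxx x); exact: infdist_le.
rewrite inE => /(open_exists_mdist oU)[r r0 xU].
apply: lt_le_trans r0 _; apply: infdist_ge => // a nUa.
by rewrite leNgt; apply/negP => /xU.
Qed.

Lemma cvg_min_indic (t : R) : 0 <= t ->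
  Num.min 1 (n%:R * t) @[n --> \oo] --> ((0 < t)%R%:R : R).
Proof.
rewrite le_eqVlt => /predU1P[<-|t0].
  by under eq_fun do rewrite mulr0; rewrite ltxx minC min_l//; exact: cvg_cst.
rewrite t0; apply: cvg_near_cst.
exists (Num.truncn t^-1).+1 => // n /= tn; apply: min_l.
rewrite -ler_pdivrMr// mul1r; apply: le_trans (ltW (truncnS_gt _)) _.
by rewrite ler_nat.
Qed.

(** Open sets generate the Borel sets and are stable under intersection, and the
    indicator of an open set [U] is the increasing limit of the continuous
    functions min(1, n dist(x, complement of U)). Both uniqueness of weak limits
    and the computation of means rest on this. *)
Lemma eq_measure_bounded_continuous (m1 m2 : probability (borel X) R) :
  (forall f : X -> R, continuous f -> (forall x, 0 <= f x <= 1) ->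
    (\int[m1]_x (f x)%:E = \int[m2]_x (f x)%:E)%E) ->
  forall B, measurable B -> m1 B = m2 B.
Proof.
move=> m12; apply: (@measure_unique _ R (borel X) (@open X) (fun _ => setT)) => //.
- by move=> A B; exact: openI.
- by move=> _; exact: openT.
- by rewrite bigcup_const//; exists 0%N.
- move=> U oU; have [U0|] := pselect (~` U !=set0); last first.
    by move=> /nonemptyPn UC0; rewrite -(setCK U) UC0 setC0;
      rewrite [LHS]probability_setT [RHS]probability_setT.
  pose f n x : R := Num.min 1 (n%:R * infdist (~` U) x).
  have d0 x : 0 <= infdist (~` U) x by apply: infdist_ge => // a _; exact: mdist_ge0.
  have f01 n x : 0 <= f n x <= 1.
    by rewrite /f ge_min lexx le_min ler01 mulr_ge0.
  have cf n : continuous (f n).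
    move=> x; apply: (@continuous_min R X (cst 1)); first exact: cst_continuous.
    by move=> ?; apply: cvgM; [exact: cvg_cst|exact: infdist_continuous].
  have lim_f (m : probability (borel X) R) :
      (\int[m]_x (f n x)%:E @[n --> \oo] --> m U)%E.
    rewrite -[U]setIT -integral_indic//; last exact: measurable_open_borel.
    apply: (@bounded_convergence _ (borel X) R m f _ 1) => [n| |n x|].
    + exact: continuous_measurable_borel.
    + by apply: measurable_indic; exact: measurable_open_borel.
    + by have /andP[f0 f1] := f01 n x; rewrite ger0_norm.
    + by apply: aeW => x /=; rewrite indicE -(infdist_gt0 x oU U0); exact: cvg_min_indic.
  apply: (cvg_unique _ (lim_f m1)) => //.
  rewrite (_ : (fun n => _) = (fun n => \int[m2]_x (f n x)%:E)%E); first exact: lim_f.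
  by apply/funext => n; exact: m12.
- by move=> _; rewrite [X in (X < _)%E](probability_setT m1) ltry.
Qed.
End measure_determination.

(** * Lower bounds along countable partitions *)

Lemma near_lt_cvge (R : realType) (u : nat -> \bar R) (l c : \bar R) :
  (u n @[n --> \oo] --> l -> c < l -> \forall n \near \oo, c < u n)%E.
Proof.
move=> ul cl; have : nbhs l [set x | (c < x)%E].
  by apply: open_nbhs_nbhs; split => //; exact: open_ereal_gt_ereal.
by move=> /ul.
Qed.

Section countable_lower_bound.
Local Open Scope ereal_scope.
Context d (T : measurableType d) (R : realType).

(** [g \o k] cut off outside the first [N] cells of the partition [k], which makes
    its integral a finite sum of masses. *)
Definition truncated (k : T -> nat) (g : nat -> R) N (x : T) : R :=
  if (k x < N)%N then g (k x) else 0%R.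

Lemma truncatedE k g N x :
  truncated k g N x = (\sum_(i < N) g i * \1_(k @^-1` [set (i : nat)]) x)%R.
Proof.
rewrite /truncated; case: ifPn => kN.
  rewrite (bigD1 (Ordinal kN))//= big1 ?addr0 => [|i ik].
    by rewrite indicE mem_set// mulr1.
  rewrite indicE memNset ?mulr0//= => ki; move/negP: ik; apply.
  by apply/eqP/val_inj.
rewrite big1// => i _; rewrite indicE memNset ?mulr0//= => ki.
by move: kN; rewrite ki ltn_ord.
Qed.

Lemma measurable_truncated k g N : measurable_fun setT k ->
  measurable_fun setT (truncated k g N).
Proof.
move=> mk.
rewrite (_ : truncated _ _ _ = (fun n => if (n < N)%N then g n else 0%R) \o k)//.
exact: measurableT_comp.
Qed.

Lemma integral_truncated (m : probability T R) k g N : measurable_fun setT k ->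
  (forall i, 0 <= g i)%R ->
  \int[m]_x (truncated k g N x)%:E =
  \sum_(i < N) (g i)%:E * m (k @^-1` [set (i : nat)]).
Proof.
move=> mk g0.
have mki i : measurable (k @^-1` [set i]) by exact: measurable_preimageT.
under eq_integral do rewrite truncatedE -sumEFin.
rewrite ge0_integral_sum//=.
- apply: eq_bigr => i _; under eq_integral do rewrite EFinM.
  rewrite ge0_integralZl ?lee_fin ?g0// ?integral_indic ?setIT//.
  by apply/measurable_EFinP; exact: measurable_indic.
- by move=> i; apply/measurable_EFinP; apply: measurable_funM => //; exact: measurable_indic.
- by move=> i x _; rewrite lee_fin mulr_ge0.
Qed.

End countable_lower_bound.

Section lower_bound.
Local Open Scope ereal_scope.
Context d d' (T : measurableType d) (T' : measurableType d') (R : realType).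

(** The one-sided half of a portmanteau argument. A minorant [g \o k] of [f] that
    is constant on the cells of a countable partition can be truncated to finitely
    many cells at an arbitrarily small cost for [mu], and on finitely many cells
    convergence of the masses gives convergence of the integrals. The limit lives
    on another space, which only has to carry a partition of the same masses. *)
Lemma liminf_lower_bound (nu : nat -> probability T R) (mu : probability T' R)
    (k : T -> nat) (k' : T' -> nat) (g : nat -> R) (f : T -> R) (c : R) :
  measurable_fun setT k -> measurable_fun setT k' -> measurable_fun setT f ->
  (forall i, nu n (k @^-1` [set i]) @[n --> \oo] --> mu (k' @^-1` [set i])) ->
  (forall i, 0 <= g i <= 1)%R -> (forall x, g (k x) <= f x)%R ->
  c%:E < \int[mu]_u (g (k' u))%:E ->
  \forall n \near \oo, c%:E < \int[nu n]_x (f x)%:E.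
Proof.
move=> mk mk' mf nk g01 gf cg.
have g0 i : (0 <= g i)%R by have /andP[] := g01 i.
have g1 i : (g i <= 1)%R by have /andP[] := g01 i.
have tr_cvg : \int[mu]_u (truncated k' g N u)%:E @[N --> \oo] -->
    \int[mu]_u (g (k' u))%:E.
  apply: (@bounded_convergence _ _ _ _ _ _ 1) => [N||N u|].
  - exact: measurable_truncated.
  - exact: measurableT_comp.
  - by rewrite /truncated; case: ifP => _; rewrite ger0_norm// ler01.
  - apply: aeW => u; apply: cvg_near_cst; exists (k' u).+1 => // N /=.
    by rewrite /truncated => ->.
have [N _ /(_ N (leqnn _))/= cN] := near_lt_cvge tr_cvg cg.
move: cN; rewrite integral_truncated// => cN.
have sum_cvg : \sum_(i < N) (g i)%:E * nu n (k @^-1` [set (i : nat)]) @[n --> \oo] -->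
    \sum_(i < N) (g i)%:E * mu (k' @^-1` [set (i : nat)]).
  apply: cvg_nnesum => i _; first by apply: nearW => n; rewrite mule_ge0// lee_fin.
  by apply: cvgeZl => //; exact: nk.
have := near_lt_cvge sum_cvg cN; apply: filterS => n /= /lt_le_trans; apply.
rewrite -integral_truncated//; apply: ge0_le_integral => //.
- by move=> x _; rewrite lee_fin /truncated; case: ifP.
- by apply/measurable_EFinP; exact: measurable_truncated.
- exact/measurable_EFinP.
- move=> x _; rewrite lee_fin /truncated; case: ifP => // _.
  exact: le_trans (g0 _) (gf x).
Qed.
End lower_bound.

(** * Nested partitions of the unit interval with prescribed lengths *)

Section uniform_law.
Context (R : realType).

Definition unit_interval_law :=
  mrestr (@lebesgue_measure R) (measurable_itv `[0, 1[).

HB.instance Definition _ := Measure.on unit_interval_law.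

Let unit_interval_lawT : unit_interval_law setT = 1%E.
Proof.
by rewrite /unit_interval_law /mrestr setTI lebesgue_measure_itv/= lte01 sube0.
Qed.

HB.instance Definition _ :=
  Measure_isProbability.Build _ _ _ unit_interval_law unit_interval_lawT.

End uniform_law.

Section interval_coding.
Context (R : realType).

(** The intervals are indexed by the finite sequences of children numbers leading
    to them, the deepest generation at the head. An interval [s] has length [m s],
    and its children are laid out in it from left to right without gaps. *)
Fixpoint left_end (m : seq nat -> R) (s : seq nat) : R :=
  if s is j :: s' then left_end m s' + \sum_(i < j) m (nat_of_ord i :: s') else 0.

Definition in_cell (m : seq nat -> R) (s : seq nat) (u : R) : bool :=
  left_end m s <= u < left_end m s + m s.

(** The interval of generation [k] containing [u]; for [u] outside the unit interval
    no child qualifies and the branch follows the default child. *)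
Fixpoint node (m : seq nat -> R) (u : R) (k : nat) : seq nat :=
  if k is k'.+1 then
    xget 0%N [set j | in_cell m (j :: node m u k') u] :: node m u k'
  else [::].

Lemma size_node m u k : size (node m u k) = k.
Proof. by elim: k => //= k ->. Qed.

Definition consistent (m : seq nat -> R) : Prop :=
  [/\ forall s, 0 <= m s, m [::] = 1 &
      forall s, \sum_(i < n) m (nat_of_ord i :: s) @[n --> \oo] --> m s].

Variable m : seq nat -> R.
Hypothesis m_consistent : consistent m.

Let m_ge0 s : 0 <= m s. Proof. by case: m_consistent. Qed.
Let m_nil : m [::] = 1. Proof. by case: m_consistent. Qed.
Let m_children s :
  \sum_(i < n) m (nat_of_ord i :: s) @[n --> \oo] --> m s.
Proof. by case: m_consistent => _ _; exact. Qed.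

(** The children exhaust the length of their parent, so a point of the parent
    lies to the left of the left end of some child, and the least such child is
    the right neighbour of the one containing the point. *)
Lemma in_cell_child s u : in_cell m s u -> exists j, in_cell m (j :: s) u.
Proof.
move=> /andP[su us].
have exn : exists n, u < left_end m (n :: s).
  have : \forall n \near \oo, u - left_end m s < \sum_(i < n) m (nat_of_ord i :: s).
    by apply: (cvgr_gt (m s)); [exact: m_children|rewrite ltrBlDl].
  by move=> [n _ /(_ n (leqnn n))/=]; rewrite ltrBlDl => ?; exists n.
case: (ex_minnP exn) => -[|n] un minn.
  by move: un; rewrite /= big_ord0 addr0 ltNge su.
exists n; rewrite /in_cell leNgt; apply/andP; split.
  by apply/negP => /minn; rewrite ltnn.
by move: un; rewrite /= big_ord_recr/= addrA.
Qed.

Lemma left_end_mono s j j' : (j <= j')%N -> left_end m (j :: s) <= left_end m (j' :: s).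
Proof.
move=> jj'; rewrite /= lerD2l -!(big_mkord xpredT (fun i => m (i :: s))).
by rewrite (big_cat_nat (leq0n _) jj')/= lerDl sumr_ge0.
Qed.

Lemma in_cell_inj s j j' u : in_cell m (j :: s) u -> in_cell m (j' :: s) u -> j = j'.
Proof.
wlog jj' : j j' / (j <= j')%N.
  by move=> wlg jc j'c; case: (leqP j j') => [|/ltnW] jj'; [|apply/esym]; exact: wlg jj' _ _.
move: jj'; rewrite leq_eqVlt => /predU1P[//|jj'] /andP[_ uj] /andP[ju _].
have := left_end_mono s jj'; rewrite /= big_ord_recr/= addrA => /le_trans/(_ ju).
by rewrite leNgt uj.
Qed.

Lemma in_cell_parent s j u : in_cell m (j :: s) u -> in_cell m s u.
Proof.
move=> /andP[ju uj]; apply/andP; split.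
  by apply: le_trans ju; rewrite /= lerDl sumr_ge0.
apply: lt_le_trans uj _; rewrite /= -addrA lerD2l.
have -> : \sum_(i < j) m (nat_of_ord i :: s) + m (j :: s) =
    \sum_(i < j.+1) m (nat_of_ord i :: s) by rewrite big_ord_recr.
rewrite -(cvg_lim (@Rhausdorff R) (@m_children s)).
apply: nondecreasing_cvgn_le; last by apply/cvg_ex; exists (m s); exact: m_children.
move=> a b ab; rewrite -!(big_mkord xpredT (fun i => m (i :: s))).
by rewrite (big_cat_nat (leq0n _) ab)/= lerDl sumr_ge0.
Qed.

Lemma in_cell_node u k : 0 <= u < 1 -> in_cell m (node m u k) u.
Proof.
move=> u01; elim: k => [|k IH]; first by rewrite /in_cell/= m_nil add0r.
by rewrite [node _ _ _]/=; case: xgetP => // /(_ _)nj; have [j /nj] := in_cell_child IH.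
Qed.

Lemma in_cell01 s u : in_cell m s u -> 0 <= u < 1.
Proof.
elim: s => [|j s IH]; first by rewrite /in_cell /= m_nil add0r.
by move=> /in_cell_parent.
Qed.

Lemma nodeE u s : 0 <= u < 1 -> (node m u (size s) = s) <-> in_cell m s u.
Proof.
move=> u01; split=> [<-|]; first exact: in_cell_node.
elim: s => //= j s IH jsu; have su := in_cell_parent jsu.
rewrite (IH su); congr (_ :: _); apply: xget_unique => // j' /= j'su; exact: in_cell_inj j'su jsu.
Qed.

Lemma node_out u k : ~~ (0 <= u < 1) -> node m u k = nseq k 0%N.
Proof.
move=> nu; elim: k => //= k ->; congr (_ :: _).
by case: xgetP => // j _ /in_cell01; rewrite (negbTE nu).
Qed.

(** The random branch followed by a uniform number visits [s] with probability
    [m s]: this realises the consistent family [m] as a law on branches. *)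
Lemma node_law (s : seq nat) :
  unit_interval_law [set u | node m u (size s) = s] = (m s)%:E.
Proof.
rewrite /unit_interval_law /mrestr.
rewrite (_ : _ `&` _ = `[left_end m s, left_end m s + m s[%classic).
  rewrite lebesgue_measure_itv/= lte_fin ltrDl; case: ifPn => [_|].
    by rewrite -EFinB addrAC subrr add0r.
  by rewrite -leNgt => ms0; congr EFin; apply/le_anti; rewrite ms0 m_ge0.
apply/seteqP; split => u /=; rewrite !in_itv/=.
  by move=> [us u01]; apply/nodeE.
by move=> us; have u01 := in_cell01 us; split => //; apply/nodeE.
Qed.

End interval_coding.

(** * A tree of cylinders and the random point it codes *)

Section tree_of_centers.
Context {R : realType} {X : completeMetricType R}.
Variable e : nat -> X.
Hypothesis dense_e : forall x (r : R), 0 < r -> exists n, mdist x (e n) < r.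

(** The centres of [x] at the successive precisions, the finest at the head. Two
    points sharing [k+1] entries are both within 1/(k+1) of the same centre. *)
Fixpoint address (k : nat) (x : X) : seq nat :=
  if k is k'.+1 then center dense_e k' x :: address k' x else [::].

Definition cylinder (s : seq nat) : set X := [set x | address (size s) x = s].

Lemma size_address k x : size (address k x) = k.
Proof. by elim: k => //= k ->. Qed.

Lemma measurable_address k s :
  measurable ([set x | address k x = s] : set (borel X)).
Proof.
elim: k s => [|k IH] [|j s] /=.
- by rewrite (_ : [set _ | _] = setT)//; exact/seteqP.
- by rewrite (_ : [set _ | _] = set0)//; apply/seteqP; split => x.
- by rewrite (_ : [set _ | _] = set0)//; apply/seteqP; split => x.
- rewrite (_ : [set _ | _] = center dense_e k @^-1` [set j] `&` [set x | address k x = s]).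
    by apply: measurableI => //; apply: measurable_preimageT => //; exact: measurable_center.
  by apply/seteqP; split => x /= [-> ->].
Qed.

Lemma measurable_cylinder s : measurable (cylinder s : set (borel X)).
Proof. exact: measurable_address. Qed.

Section coding.
Variable m : seq nat -> R.
Hypothesis m_consistent : consistent m.
Hypothesis m_empty : forall s, cylinder s = set0 -> m s = 0.

Definition approx (m : seq nat -> R) (u : R) (k : nat) : X :=
  e (head 0%N (node m u k.+1)).

Definition coded (m : seq nat -> R) (u : R) : X :=
  lim (approx m u k @[k --> \oo]).

Lemma address_node_le u k l x : (l <= k)%N ->
  address k x = node m u k -> address l x = node m u l.
Proof.
elim: k => [|k IH]; first by rewrite leqn0 => /eqP ->.
by rewrite leq_eqVlt ltnS => /predU1P[->//|/IH{}IH] [_ /IH].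
Qed.

Lemma mdist_approx u k l x : (l < k)%N ->
  address k x = node m u k -> mdist x (approx m u l) < l.+1%:R^-1.
Proof.
move=> lk /(address_node_le lk); rewrite /approx => <- /=; exact: center_lt.
Qed.

(** A random branch only visits intervals of positive length, hence cylinders of
    positive mass, which are inhabited. *)
Lemma node_inhabited u k : 0 <= u < 1 -> exists x, address k x = node m u k.
Proof.
move=> u01; have /andP[um mu] := in_cell_node m_consistent k u01.
have : cylinder (node m u k) !=set0.
  apply/set0P/eqP => /m_empty mk0; move: mu.
  by rewrite mk0 addr0 ltNge um.
by move=> [x]; rewrite /cylinder/= size_node => xk; exists x.
Qed.

Lemma invS_le (l k : nat) : (k <= l)%N -> l.+1%:R^-1 <= k.+1%:R^-1 :> R.
Proof. by move=> kl; rewrite lef_pV2 ?posrE// ler_nat. Qed.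

(** A point of the deeper cylinder is close to both centres; with completeness
    this makes the random branch converge. *)
Lemma approx_close u k l : 0 <= u < 1 -> (k <= l)%N ->
  mdist (approx m u k) (approx m u l) < 2 * k.+1%:R^-1.
Proof.
move=> u01 kl; have [x xl] := node_inhabited l.+1 u01.
apply: le_lt_trans (metric_triangle _ x _) _.
rewrite mulr_natl mulr2n ltrD//.
  by rewrite metric_sym; apply: mdist_approx xl; rewrite ltnS.
by apply: lt_le_trans (mdist_approx _ xl) (invS_le kl).
Qed.

(** Outside the unit interval the branch is constantly zero, so that [coded] is
    the limit of its approximations everywhere and measurability needs no
    restriction of the domain. *)
Lemma approx_cvg u : cvg (approx m u k @[k --> \oo]).
Proof.
have [u01|nu] := boolP (0 <= u < 1); last first.
  apply/cvg_ex; exists (e 0%N); apply: cvg_near_cst; apply: nearW => k.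
  by rewrite /approx (node_out m_consistent).
apply: cauchy_cvg; apply: cauchy_exP => r r0.
have [k] := ltr_add_invr (divr_gt0 r0 (ltr0n R 2)); rewrite add0r => kr.
exists (approx m u k); exists k => // l kl; rewrite ballEmdist/=.
apply: lt_trans (approx_close u01 kl) _.
by rewrite -ltr_pdivlMl// mulrC.
Qed.

Lemma approx_cvg_coded u : approx m u k @[k --> \oo] --> coded m u.
Proof. exact: approx_cvg. Qed.

Lemma mdist_coded u k x : 0 <= u < 1 -> address k.+1 x = node m u k.+1 ->
  mdist (coded m u) x < 4 * k.+1%:R^-1.
Proof.
move=> u01 xk.
have k0 : 0 < k.+1%:R^-1 :> R by rewrite invr_gt0.
have /metricType_numDomainType.cvgrPdist_lt/(_ _ k0)[N _ aN] := @approx_cvg_coded u.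
have := aN (maxn N k) (leq_maxl _ _) => /= h1.
have h2 := approx_close u01 (leq_maxr N k).
have h3 := mdist_approx (ltnSn k) xk.
have -> : 4 * k.+1%:R^-1 = k.+1%:R^-1 + (2 * k.+1%:R^-1 + k.+1%:R^-1) :> R by ring.
apply: le_lt_trans (metric_triangle _ (approx m u (maxn N k)) _) _; apply: ltrD => //.
apply: le_lt_trans (metric_triangle _ (approx m u k) _) _.
by rewrite ltrD// metric_sym.
Qed.

End coding.
End tree_of_centers.

Section coded_law.
Context {R : realType} {X : completeMetricType R}.
Variable e : nat -> X.
Hypothesis dense_e : forall x (r : R), 0 < r -> exists n, mdist x (e n) < r.
Context d (T : measurableType d).
Variable m : T -> seq nat -> R.
Hypothesis mm : forall s, measurable_fun setT (m ^~ s).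
Hypothesis m_consistent : forall w, consistent (m w).
Hypothesis m_empty : forall w s, cylinder dense_e s = set0 -> m w s = 0.

Lemma measurable_left_end s : measurable_fun setT (fun w => left_end (m w) s).
Proof.
elim: s => [|j s IH] /=; first exact: measurable_cst.
by apply: measurable_funD => //; apply: measurable_sum => i; exact: mm.
Qed.

Lemma measurable_in_cell s : measurable
  [set p : T * measurableTypeR R | in_cell (m p.1) s p.2].
Proof.
rewrite (_ : [set _ | _] =
  [set p | left_end (m p.1) s <= p.2] `&` [set p | p.2 < left_end (m p.1) s + m p.1 s]); last first.
  by apply/seteqP; split => p /=; rewrite /in_cell => /andP.
have ml : measurable_fun setT (fun p : T * measurableTypeR R => left_end (m p.1) s).
  by apply: (measurableT_comp (measurable_left_end s)); exact: measurable_fst.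
have mm1 : measurable_fun setT (fun p : T * measurableTypeR R => m p.1 s).
  by apply: (measurableT_comp (mm s)); exact: measurable_fst.
have m2 : measurable_fun setT (fun p : T * measurableTypeR R => p.2 : R).
  exact: measurable_snd.
apply: measurableI.
- rewrite -[X in measurable X]setTI; apply: measurable_fun_ler => //.
- rewrite -[X in measurable X]setTI; apply: measurable_fun_ltr => //.
  exact: measurable_funD.
Qed.

Lemma measurable_node k s : measurable
  [set p : T * measurableTypeR R | node (m p.1) p.2 k = s].
Proof.
have [sk|sk] := eqVneq (size s) k; last first.
  rewrite (_ : [set _ | _] = set0)//; apply/seteqP; split => // p /= ps.
  by move: sk; rewrite -ps size_node eqxx.
pose I := [set p : T * measurableTypeR R | in_cell (m p.1) [::] p.2].
have IE p : I p <-> 0 <= p.2 < 1.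
  by rewrite /I/= /in_cell/= add0r; case: (m_consistent p.1) => _ -> _.
have mI : measurable I by exact: measurable_in_cell.
rewrite (_ : [set _ | _] = [set p : T * measurableTypeR R | in_cell (m p.1) s p.2] `|`
   (~` I `&` [set _ | s = nseq k 0%N])).
  apply: measurableU; first exact: measurable_in_cell.
  apply: measurableI; first exact: measurableC.
  have [sE|nE] := pselect (s = nseq k 0%N).
    by rewrite (_ : mkset _ = setT)//; apply/seteqP; split.
  by rewrite (_ : mkset _ = set0)//; apply/seteqP; split.
rewrite -sk; apply/seteqP; split => p /=.
- have [u01|nu] := boolP (0 <= p.2 < 1).
    by move/(nodeE (m_consistent _) _ u01); left.
  rewrite (node_out (m_consistent _))// => ps; right.
  by split => // /IE; apply/negP.
- move=> [ps|[nI ->]].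
    have u01 := in_cell01 (m_consistent _) ps.
    by apply/(nodeE (m_consistent _) _ u01).
  rewrite size_nseq (node_out (m_consistent _))//.
  by apply/negP => /IE.
Qed.

Lemma measurable_coded : measurable_fun setT
  (fun p : T * measurableTypeR R => coded e (m p.1) p.2 : borel X).
Proof.
apply: (@measurable_lim_borel R X _ (T * measurableTypeR R)%type
  (fun k p => approx e (m p.1) p.2 k)) => [k|p]; last first.
  exact: (approx_cvg_coded (m_consistent p.1) (@m_empty p.1)).
apply: (@measurable_fun_countable _ _ (T * measurableTypeR R)%type (borel X) (seq nat)
  (fun p => node (m p.1) p.2 k.+1) (fun s => e (head 0%N s))) => s.
exact: measurable_node.
Qed.

Lemma measurable_coded_section w : measurable_fun setT
  (fun u : measurableTypeR R => coded e (m w) u : borel X).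
Proof.
have mw : measurable_fun setT (fun u : measurableTypeR R => (w, u)).
  exact: measurable_fun_pair.
exact: measurableT_comp measurable_coded mw.
Qed.

Variables (w : T) (nu : nat -> probability (borel X) R).
Hypothesis nu_cvg : forall s,
  (nu n (cylinder dense_e s) @[n --> \oo] --> (m w s)%:E)%E.

(** On the cylinders of generation [k], bound [f] from below by its infimum. Along
    the branch of [u] these infima tend to the value of [f] at the coded point, as
    the cylinders shrink to it. One generation is therefore enough to exceed [c],
    and on that generation only masses of cylinders matter. *)
Lemma coded_lower_bound (f : X -> R) (c : R) : continuous f ->
  (forall x, 0 <= f x <= 1) ->
  (c%:E < \int[@unit_interval_law R]_u (f (coded e (m w) u))%:E)%E ->
  \forall n \near \oo, (c%:E < \int[nu n]_x (f x)%:E)%E.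
Proof.
move=> cf f01 cint.
pose k_ k (x : X) := pickle (address dense_e k x).
pose k'_ k (u : R) := pickle (node (m w) u k).
pose g k i := inf [set f x | x in [set x | k_ k x = i]].
have lbf k i : has_lbound [set f x | x in [set x | k_ k x = i]].
  by exists 0 => _ [x _ <-]; have /andP[] := f01 x.
have g01 k i : 0 <= g k i <= 1.
  have [[x kx]|/nonemptyPn E0] := pselect ([set x | k_ k x = i] !=set0); last first.
    by rewrite /g E0 image_set0 inf0 lexx ler01.
  apply/andP; split.
    by apply: lb_le_inf => [|_ [y _ <-]]; [exists (f x), x|have /andP[] := f01 y].
  by apply: (le_trans (y := f x)); [apply: ge_inf => //; exists x|have /andP[] := f01 x].
have mk k : measurable_fun setT (k_ k : borel X -> nat).
  apply: (@measurable_fun_countable _ _ (borel X) nat _ (address dense_e k) pickle) => s.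
  exact: measurable_address.
have mk' k : measurable_fun setT (k'_ k : measurableTypeR R -> nat).
  apply: (@measurable_fun_countable _ _ (measurableTypeR R) nat _
    (fun u => node (m w) u k) pickle) => s.
  have mw : measurable_fun setT (fun u : measurableTypeR R => (w, u)).
    exact: measurable_fun_pair.
  exact: (measurable_preimageT mw (measurable_node k s)).
(* points sharing l + 1 entries with the branch are at distance less than
   4 / (l + 1) from the coded point, whence the choice of K *)
have inf_cvg u : 0 <= u < 1 -> g k (k'_ k u) @[k --> \oo] --> f (coded e (m w) u).
  move=> u01; set c0 := coded e (m w) u.
  apply/cvgrPdist_le => r r0.
  have /cvgrPdist_lt/(_ r r0) : f y @[y --> c0] --> f c0 by exact: cf.
  move=> /nbhs_ballP[r' /= r'0 fr'].
  have [K] := ltr_add_invr (divr_gt0 r'0 (ltr0n R 4)); rewrite add0r => Kr'.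
  exists K.+1 => // -[//|l] Kl /=.
  have [x0 x0l] := node_inhabited (m_consistent w) (@m_empty w) l.+1 u01.
  have close y : k_ l.+1 y = k'_ l.+1 u -> `|f c0 - f y| <= r.
    move=> /(pcan_inj pickleK) yl; apply/ltW/fr'; rewrite ballEmdist/=.
    apply: lt_trans (mdist_coded (m_consistent w) (@m_empty w) u01 yl) _.
    rewrite mulrC -ltr_pdivlMr//; apply: le_lt_trans Kr'; exact: invS_le.
  have kx0 : k_ l.+1 x0 = k'_ l.+1 u by rewrite /k_ x0l.
  have gx0 : g l.+1 (k'_ l.+1 u) <= f x0 by apply: ge_inf => //; exists x0.
  have gc : f c0 - r <= g l.+1 (k'_ l.+1 u).
    apply: lb_le_inf => [|_ [y /close + <-]]; first by exists (f x0), x0.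
    by rewrite ler_norml => /andP[_]; rewrite lerBlDr lerBlDl addrC.
  have := close _ kx0; rewrite !ler_norml => /andP[fr _].
  by apply/andP; split; lra.
(* the coded point is only controlled for u in [0, 1[, which has full measure *)
have g_cvg : (\int[@unit_interval_law R]_u (g k (k'_ k u))%:E @[k --> \oo] -->
    \int[@unit_interval_law R]_u (f (coded e (m w) u))%:E)%E.
  apply: (@bounded_convergence _ _ _ _ _ _ 1) => [k||k u|].
  - exact: measurableT_comp.
  - apply: (measurableT_comp (continuous_measurable_borel cf)).
    exact: measurable_coded_section.
  - by have /andP[? ?] := g01 k (k'_ k u); rewrite ger0_norm.
  - exists (~` `[0, 1[); split.
    + by apply: measurableC; exact: measurable_itv.
    + rewrite -[LHS]/(lebesgue_measure (~` `[0, 1[%classic `&` `[0, 1[%classic)).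
      by rewrite setICl measure0.
    apply: subsetC => u; rewrite /= in_itv/= => u01; exact: inf_cvg.
have [k _ /(_ k (leqnn k))/= ck] := near_lt_cvge g_cvg cint.
apply: (@liminf_lower_bound _ _ (borel X) (measurableTypeR R) R nu
  (@unit_interval_law R) (k_ k) (k'_ k) (g k) f c) => //.
- exact: continuous_measurable_borel.
- move=> i; have [[s [sk si]]|nsi] := pselect
    (exists s : seq nat, size s = k /\ pickle s = i).
    rewrite (_ : k_ k @^-1` [set i] = cylinder dense_e s); last first.
      rewrite /k_ -si /cylinder sk; apply/seteqP; split => x /=; last by move=> ->.
      exact: (pcan_inj pickleK).
    rewrite (_ : k'_ k @^-1` [set i] = [set u | node (m w) u (size s) = s]); last first.
      rewrite /k'_ -si sk; apply/seteqP; split => x /=; last by move=> ->.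
      exact: (pcan_inj pickleK).
    rewrite [X in _ --> X](_ : _ = (m w s)%:E); first exact: nu_cvg.
    exact: node_law.
  rewrite (_ : k_ k @^-1` [set i] = set0); last first.
    apply/seteqP; split => // x /= xi; apply: nsi; exists (address dense_e k x).
    by rewrite size_address.
  rewrite (_ : k'_ k @^-1` [set i] = set0); last first.
    apply/seteqP; split => // u /= ui; apply: nsi; exists (node (m w) u k).
    by rewrite size_node.
  rewrite measure0; under eq_fun do rewrite measure0; exact: cvg_cst.
- by move=> x; apply: ge_inf => //; exists x.
Qed.

End coded_law.

(** * Weak convergence from the masses of cylinders *)

Section affine.
Local Open Scope ereal_scope.
Context d (T : measurableType d) (R : realType) (m : probability T R).

Lemma probability_integrable (f : T -> R) (M : R) : measurable_fun setT f ->
  (forall x, `|f x| <= M)%R -> m.-integrable setT (EFin \o f).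
Proof.
move=> mf fM; apply: measurable_bounded_integrable => //.
  by rewrite [X in X < _](probability_setT m) ltry.
by exists M; split; [exact: num_real|move=> y My x _; exact: le_trans (ltW My)].
Qed.

Lemma integral_affine (f : T -> R) (a b : R) : m.-integrable setT (EFin \o f) ->
  \int[m]_x (a * f x + b)%:E = a%:E * \int[m]_x (f x)%:E + b%:E.
Proof.
move=> fi; under eq_integral do rewrite EFinD EFinM.
rewrite integralD//=; last 2 first.
- exact: integrableZl.
- exact: finite_measure_integrable_cst.
by rewrite integralZl// integral_cst// [X in _ + _ * X](probability_setT m) mule1.
Qed.

End affine.

(** The class of functions is stable under [f |-> 1 - f], so lower bounds are also
    upper bounds; a general bounded function is an affine image of one with values
    in the unit interval. *)
Lemma weak_cvg_lower_bound (R : realType) (X : completeMetricType R)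
    (nu : nat -> probability (borel X) R) (mu : probability (borel X) R) :
  (forall (f : X -> R) (c : R), continuous f -> (forall x, 0 <= f x <= 1) ->
    (c%:E < \int[mu]_x (f x)%:E)%E ->
    \forall n \near \oo, (c%:E < \int[nu n]_x (f x)%:E)%E) ->
  weak_cvg nu mu.
Proof.
move=> lb f cf [M fM].
have M0 : 0 <= M by exact: le_trans (fM point).
pose K : R := M + 1; have K0 : 0 < K by rewrite ltr_pwDr.
pose h x := (2 * K)^-1 * f x + 2^-1.
have ch (a b : R) (g : X -> R) : continuous g -> continuous (fun x => a * g x + b).
  by move=> cg x; apply: cvgD; [apply: cvgM; [exact: cvg_cst|exact: cg]|exact: cvg_cst].
have h01 x : 0 <= h x <= 1.
  have := fM x; rewrite ler_norml => /andP[f1 f2].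
  have -> : h x = (f x + K) / (2 * K) by rewrite /h; field; rewrite lt0r_neq0.
  rewrite divr_ge0 ?mulr_ge0 ?(ltW K0)//; last by rewrite /K; lra.
  by rewrite ler_pdivrMr ?mulr_gt0// /K; lra.
have hK x : f x = (2 * K) * h x + - K.
  by rewrite /h; field; rewrite lt0r_neq0.
have hi (m : probability (borel X) R) : m.-integrable setT (EFin \o (h : borel X -> R)).
  apply: (@probability_integrable _ (borel X) R m h 1).
    by apply: continuous_measurable_borel; exact: ch.
  by move=> x; have /andP[? ?] := h01 x; rewrite ger0_norm.
have hfin (m : probability (borel X) R) : (\int[m]_x (h x)%:E)%E \is a fin_num.
  exact: (integrable_fin_num measurableT (hi m)).
have fE (m : probability (borel X) R) :
    (\int[m]_x (f x)%:E = (2 * K)%:E * \int[m]_x (h x)%:E + (- K)%:E)%E.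
  by rewrite -(integral_affine _ _ (hi m)); apply: eq_integral => x _; rewrite -hK.
rewrite fE (_ : (fun n => _) = fun n =>
  ((2 * K)%:E * \int[nu n]_x (h x)%:E + (- K)%:E)%E); last by apply/funext => n; exact: fE.
apply: cvgeD; [by rewrite fin_num_adde_defl| |exact: cvg_cst].
apply: cvgeZl => //.
rewrite -(fineK (hfin mu)) (_ : (fun n => _) = fun n => (fine (\int[nu n]_x (h x)%:E))%:E)%E;
  last by apply/funext => n; rewrite fineK.
apply: cvg_EFin; first exact: nearW.
apply/cvgrPdist_lt => r r0 /=.
have h1 : \forall n \near \oo,
    ((fine (\int[mu]_x (h x)%:E) - r)%:E < \int[nu n]_x (h x)%:E)%E.
  apply: (lb) => //; first exact: ch.
  by rewrite -[X in (_ < X)%E](fineK (hfin mu)) lte_fin ltrBlDr ltrDl.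
have nE (m : probability (borel X) R) :
    (\int[m]_x (-1 * h x + 1)%:E = (1 - fine (\int[m]_x (h x)%:E))%:E)%E.
  by rewrite integral_affine// -(fineK (hfin m))/= -EFinM -EFinD mulN1r addrC.
have h2 : \forall n \near \oo,
    ((1 - fine (\int[mu]_x (h x)%:E) - r)%:E < \int[nu n]_x (-1 * h x + 1)%:E)%E.
  apply: (lb); first by apply: (ch); exact: ch.
    by move=> x; have := h01 x; lra.
  by rewrite nE lte_fin ltrBlDr ltrDl.
near=> n; have a : ((fine (\int[mu]_x (h x)%:E) - r)%:E < \int[nu n]_x (h x)%:E)%E by near: n.
have b : ((1 - fine (\int[mu]_x (h x)%:E) - r)%:E < \int[nu n]_x (-1 * h x + 1)%:E)%E by near: n.
move: a b; rewrite nE -[X in (_ < X)%E -> _](fineK (hfin (nu n))) !lte_fin => a b.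
by rewrite ltr_norml; apply/andP; split; lra.
Unshelve. all: by end_near. Qed.

Section coded_probability.
Context {R : realType} {X : completeMetricType R}.
Variable e : nat -> X.
Hypothesis dense_e : forall x (r : R), 0 < r -> exists n, mdist x (e n) < r.
Context d (T : measurableType d).
Variable m : T -> seq nat -> R.
Hypothesis mm : forall s, measurable_fun setT (m ^~ s).
Hypothesis m_consistent : forall w, consistent (m w).
Hypothesis m_empty : forall w s, cylinder dense_e s = set0 -> m w s = 0.

Definition coded_law (w : T) : probability (borel X) R :=
  image_law (@unit_interval_law R) (measurable_coded_section mm m_consistent m_empty w).

(** Consistency of the limit masses says that no mass escapes, which turns
    convergence on cylinders into weak convergence. *)
Lemma coded_law_weak_cvg w (nu : nat -> probability (borel X) R) :
  (forall s, nu n (cylinder dense_e s) @[n --> \oo] --> (m w s)%:E)%E ->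
  weak_cvg nu (coded_law w).
Proof.
move=> nu_m; apply: weak_cvg_lower_bound => f c cf f01.
rewrite ge0_integral_image_law//; first last.
- by move=> y; rewrite lee_fin; have /andP[] := f01 y.
- by apply/measurable_EFinP; exact: continuous_measurable_borel.
exact: (coded_lower_bound mm m_consistent m_empty nu_m).
Qed.

End coded_probability.

(** * Bounded reversed martingales indexed by the reals *)

Section sub_measurable_fun.
Context d d' (T : measurableType d) (T' : measurableType d').

Lemma sub_measurable_fun (G : set (set T)) (f : T -> T') : G `<=` measurable ->
  measurable_fun [set: g_sigma_algebraType G] (f : g_sigma_algebraType G -> T') ->
  measurable_fun [set: T] f.
Proof.
move=> GM mf _ B mB; rewrite setTI.
have : <<s G >> (f @^-1` B) by rewrite -[f @^-1` B]setTI; exact: mf.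
by apply: smallest_sub => //; exact: sigma_algebra_measurable.
Qed.

End sub_measurable_fun.

Section bounded_measurable.
Context (R : realType) (T : pointedType).
Implicit Types (G : set (set T)) (f g : T -> R).

(** Measurability is with respect to the sigma-algebra generated by [G], which is
    [G] itself whenever [G] is a sigma-algebra. *)
Definition bounded_measurable G f : Prop :=
  measurable_fun [set: g_sigma_algebraType G] (f : g_sigma_algebraType G -> R) /\
  exists K : R, forall x, `|f x| <= K.

Lemma bounded_measurable_cst G (c : R) : bounded_measurable G (fun=> c).
Proof. by split; [exact: measurable_cst|exists `|c|]. Qed.

Lemma bounded_measurableD G f g : bounded_measurable G f ->
  bounded_measurable G g -> bounded_measurable G (fun x => f x + g x).
Proof.
move=> [mf [K fK]] [mg [L gL]]; split; first exact: measurable_funD.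
by exists (K + L) => x; rewrite (le_trans (ler_normD _ _))// lerD.
Qed.

Lemma bounded_measurableM G f g : bounded_measurable G f ->
  bounded_measurable G g -> bounded_measurable G (fun x => f x * g x).
Proof.
move=> [mf [K fK]] [mg [L gL]]; split; first exact: measurable_funM.
by exists (K * L) => x; rewrite normrM ler_pM.
Qed.

Lemma bounded_measurableN G f : bounded_measurable G f ->
  bounded_measurable G (fun x => - f x).
Proof.
move=> bf; rewrite (_ : (fun _ => _) = (fun x => -1 * f x)).
  by apply: bounded_measurableM => //; exact: bounded_measurable_cst.
by apply/funext => x; rewrite mulN1r.
Qed.

Lemma bounded_measurableB G f g : bounded_measurable G f ->
  bounded_measurable G g -> bounded_measurable G (fun x => f x - g x).
Proof. by move=> bf bg; apply: bounded_measurableD => //; exact: bounded_measurableN. Qed.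

Lemma bounded_measurable_indic G (A : set T) : <<s G >> A -> bounded_measurable G \1_A.
Proof.
move=> GA; split; first exact: (@measurable_indic _ (g_sigma_algebraType G)).
by exists 1 => x; rewrite indicE; case: (_ \in _); rewrite ?normr1 ?normr0 ?ler01.
Qed.

Lemma bounded_measurableS G H f : G `<=` <<s H >> -> bounded_measurable G f ->
  bounded_measurable H f.
Proof.
move=> GH [mf bf]; split => //.
exact: (@sub_measurable_fun _ _ (g_sigma_algebraType H) R G).
Qed.

End bounded_measurable.

Section expectation.
Context d (T : measurableType d) (R : realType) (P : probability T R).
Implicit Types f g : T -> R.

Notation bmeas f := (bounded_measurable (@measurable _ T) f).

Lemma bounded_measurable_integrable f : bmeas f -> P.-integrable setT (EFin \o f).
Proof.
move=> [mf [K fK]]; apply: probability_integrable fK.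
exact: sub_measurable_fun mf.
Qed.

Lemma bounded_RintegralD f g : bmeas f -> bmeas g ->
  \int[P]_w (f w + g w) = \int[P]_w f w + \int[P]_w g w.
Proof. by move=> bf bg; rewrite RintegralD//; exact: bounded_measurable_integrable. Qed.

Lemma bounded_RintegralB f g : bmeas f -> bmeas g ->
  \int[P]_w (f w - g w) = \int[P]_w f w - \int[P]_w g w.
Proof. by move=> bf bg; rewrite RintegralB//; exact: bounded_measurable_integrable. Qed.

Lemma bounded_RintegralZ (c : R) f : bmeas f -> \int[P]_w (c * f w) = c * \int[P]_w f w.
Proof. by move=> bf; rewrite RintegralZl//; exact: bounded_measurable_integrable. Qed.

Lemma le_bounded_Rintegral f g : bmeas f -> bmeas g -> (forall w, f w <= g w) ->
  \int[P]_w f w <= \int[P]_w g w.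
Proof. by move=> bf bg fg; apply: le_Rintegral => //; exact: bounded_measurable_integrable. Qed.

Lemma Rintegral_indicator (A : set T) : measurable A -> \int[P]_w \1_A w = fine (P A).
Proof. by move=> mA; rewrite /Rintegral integral_indic// setIT. Qed.

End expectation.

Lemma negligible_small d (T : measurableType d) (R : realType)
    (P : probability T R) (N : set T) :
  (forall r : R, 0 < r -> exists B, [/\ measurable B, (P B <= r%:E)%E & N `<=` B]) ->
  P.-negligible N.
Proof.
move=> smallN.
have /choice[B HB] : forall k, exists B, [/\ measurable B, (P B <= (k.+1%:R^-1)%:E)%E & N `<=` B].
  by move=> k; apply: smallN; rewrite invr_gt0.
have mB k : measurable (B k) by case: (HB k).
exists (\bigcap_k B k); split; last by move=> w Nw k _; case: (HB k) => _ _; exact.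
  exact: bigcapT_measurable.
have mI : measurable (\bigcap_k B k) by exact: bigcapT_measurable.
have PI k : fine (P (\bigcap_k B k)) <= k.+1%:R^-1.
  rewrite -lee_fin fineK ?fin_num_measure//.
  case: (HB k) => _ + _; apply: le_trans; apply: le_measure; rewrite ?inE//.
  exact: bigcap_inf.
have : fine (P (\bigcap_k B k)) <= 0.
  rewrite leNgt; apply/negP => /ltr_add_invr[k]; rewrite add0r ltNge.
  by rewrite PI.
by move=> P0; apply/le_anti; rewrite measure_ge0 andbT -[X in (X <= _)%E]fineK ?fin_num_measure.
Qed.

(** [G s] shrinks as [s] grows, and [mart] says that [M s] is the conditional
    expectation of [M r] given [G s], for [r <= s], in the form of a test against
    bounded weights. Time runs towards minus infinity, where the sigma-algebras
    are large. *)
Section reversed_martingale.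
Context d (T : measurableType d) (R : realType) (P : probability T R).
Variables (t0 : R) (M : R -> T -> R) (G : R -> set (set T)).
Hypothesis sG : forall s, sigma_algebra setT (G s).
Hypothesis GM : forall s, G s `<=` measurable.
Hypothesis G_anti : forall r s, r <= s -> G s `<=` G r.
Hypothesis bM : forall s, s <= t0 -> bounded_measurable (G s) (M s).
Hypothesis M01 : forall s w, s <= t0 -> 0 <= M s w <= 1.
Hypothesis mart : forall r s W, r <= s -> s <= t0 -> bounded_measurable (G s) W ->
  \int[P]_w (W w * M r w) = \int[P]_w (W w * M s w).

Notation bmeas f := (bounded_measurable (@measurable _ T) f).

Let bmG s (f : T -> R) : bounded_measurable (G s) f -> bmeas f.
Proof.
apply: bounded_measurableS; apply: subset_trans (@GM s) _; exact: sub_sigma_algebra.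
Qed.

Let bmGG r s (f : T -> R) : r <= s -> bounded_measurable (G s) f -> bounded_measurable (G r) f.
Proof.
move=> rs; apply: bounded_measurableS; apply: subset_trans (G_anti rs) _.
exact: sub_sigma_algebra.
Qed.

Let indic_bm s A : G s A -> bounded_measurable (G s) (\1_A : T -> R).
Proof. by move=> GA; apply: bounded_measurable_indic; exact: sub_sigma_algebra. Qed.

(** The increment [M q - M s] is orthogonal to the [G s]-measurable weight
    [\1_A * (M s - Z)], so the cross term of the square vanishes. *)
Lemma reversed_martingale_pythagoras q s A Z : q <= s -> s <= t0 -> G s A ->
  bounded_measurable (G s) Z ->
  \int[P]_w (\1_A w * (M q w - Z w) ^+ 2) =
  \int[P]_w (\1_A w * (M q w - M s w) ^+ 2) +
  \int[P]_w (\1_A w * (M s w - Z w) ^+ 2).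
Proof.
move=> qs st0 GA bZ; have qt0 := le_trans qs st0.
have bA := indic_bm GA.
have [bA' bq bs bZ'] : [/\ bmeas (\1_A : T -> R), bmeas (M q), bmeas (M s) & bmeas Z].
  by split; [exact: bmG bA|exact: bmG (bM qt0)|exact: bmG (bM st0)|exact: bmG bZ].
pose W w := \1_A w * (M s w - Z w).
have bW : bounded_measurable (G s) W.
  by apply: bounded_measurableM => //; apply: bounded_measurableB => //; exact: bM.
have sqr (f g : T -> R) : bmeas f -> bmeas g -> bmeas (fun w => \1_A w * (f w - g w) ^+ 2).
  move=> bf bg; apply: bounded_measurableM => //.
  by apply: (bounded_measurableM (f := fun w => f w - g w)); exact: bounded_measurableB.
have WM r : r <= t0 -> bmeas (fun w => W w * M r w).
  by move=> rt0; apply: bounded_measurableM (bmG bW) (bmG (bM rt0)).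
under [LHS]eq_Rintegral => w _.
  rewrite (_ : _ * _ = \1_A w * (M q w - M s w) ^+ 2 + \1_A w * (M s w - Z w) ^+ 2 +
    2 * (W w * M q w - W w * M s w)); last by rewrite /W; ring.
  over.
rewrite bounded_RintegralD; [|by apply: bounded_measurableD; exact: sqr|]; last first.
  apply: bounded_measurableM; first exact: bounded_measurable_cst.
  by apply: bounded_measurableB; exact: WM.
rewrite bounded_RintegralD; [|exact: sqr|exact: sqr].
rewrite bounded_RintegralZ ?bounded_RintegralB; [|exact: WM|exact: WM|]; last first.
  by apply: bounded_measurableB; exact: WM.
by rewrite (mart qs st0 bW) subrr mulr0 addr0.
Qed.

Let sqr_bm A (f g : T -> R) : measurable A -> bmeas f -> bmeas g ->
  bmeas (fun w => \1_A w * (f w - g w) ^+ 2).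
Proof.
move=> mA bf bg; apply: bounded_measurableM.
  by apply: bounded_measurable_indic; exact: sub_sigma_algebra.
by apply: (bounded_measurableM (f := fun w => f w - g w)); exact: bounded_measurableB.
Qed.

Let bad_G r (eps : R) Z : r <= t0 -> bounded_measurable (G r) Z ->
  G r [set w | eps <= `|M r w - Z w|].
Proof.
move=> rt0 bZ; have [mMZ _] := bounded_measurableB (bM rt0) bZ.
rewrite -[G r](sigma_algebra_id (sG r)) -[X in <<s _ >> X]setTI.
apply: (@measurable_fun_ler _ (g_sigma_algebraType (G r))) => //.
exact: (measurableT_comp (@normr_measurable R setT)).
Qed.

Let mhas (eps : R) l Z : all (fun r => r <= t0) l -> bmeas Z ->
  measurable [set w | has (fun r => eps <= `|M r w - Z w|) l].
Proof.
move=> + bZ; elim: l => [|r l IH] /=.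
  by move=> _; rewrite (_ : [set w | _] = set0)//; apply/seteqP; split.
move=> /andP[rt0 /IH ml].
rewrite (_ : [set w | _] = [set w | eps <= `|M r w - Z w|] `|`
    [set w | has (fun r => eps <= `|M r w - Z w|) l]); last first.
  by apply/seteqP; split => w /= /orP.
apply: measurableU => //.
have [mMZ _] := bounded_measurableB (bmG (bM rt0)) bZ.
have {}mMZ : measurable_fun setT (fun w => M r w - Z w) by exact: sub_measurable_fun mMZ.
rewrite -[X in measurable X]setTI; apply: measurable_fun_ler => //.
exact: (measurableT_comp (@normr_measurable R setT)).
Qed.

(** Kolmogorov's maximal inequality, for deviations from a variable known at time
    [s]. The event is split according to the first time [r] in the list at which
    the deviation reaches [eps]: at that time, the part of [A] where it does so is
    [G r]-measurable, and on it the deviation at the final time [q] is at least as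
    large in mean square; the induction continues on the rest of [A], which is why
    [A] is general. *)
Lemma reversed_martingale_maximal (eps : R) q (l : seq R) s A Z : 0 < eps ->
  path >=%R s l -> all (>= q) l -> s <= t0 -> G s A ->
  bounded_measurable (G s) Z ->
  eps ^+ 2 * fine (P (A `&` [set w | has (fun r => eps <= `|M r w - Z w|) l])) <=
  \int[P]_w (\1_A w * (M q w - Z w) ^+ 2).
Proof.
move=> eps0.
elim: l s A => [|r l IH] s A.
  move=> _ _ _ _ _; rewrite (_ : [set w | _] = set0); last first.
    by apply/seteqP; split.
  rewrite setI0 measure0 mulr0; apply: Rintegral_ge0 => w _.
  by rewrite mulr_ge0 ?sqr_ge0.
move=> /= /andP[rs rl] /andP[qr qall] st0 GsA bsZ.
have rt0 := le_trans rs st0; have qt0 := le_trans qr rt0.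
have GA := G_anti rs GsA; have bZ := bmGG rs bsZ.
pose B := [set w | eps <= `|M r w - Z w|].
have GB : G r B by exact: bad_G.
have [_ GC GU] := sG r.
have GI C D : G r C -> G r D -> G r (C `&` D).
  rewrite -(sigma_algebra_id (sG r)) => mC mD.
  exact: (@measurableI _ (g_sigma_algebraType (G r))).
have GAB : G r (A `&` B) by exact: GI.
have GAD : G r (A `\` B) by rewrite setDE; apply: GI => //; rewrite -setTD; exact: GC.
have [mA mAB mAD] : [/\ measurable A, measurable (A `&` B) & measurable (A `\` B)].
  by split; [exact: GM GA|exact: GM GAB|exact: GM GAD].
have [bq br bZ'] : [/\ bmeas (M q), bmeas (M r) & bmeas Z].
  by split; [exact: bmG (bM qt0)|exact: bmG (bM rt0)|exact: bmG bZ].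
have first_step : eps ^+ 2 * fine (P (A `&` B)) <=
    \int[P]_w (\1_(A `&` B) w * (M q w - Z w) ^+ 2).
  rewrite (reversed_martingale_pythagoras qr rt0 GAB bZ).
  apply: (le_trans (y := \int[P]_w (\1_(A `&` B) w * (M r w - Z w) ^+ 2))); last first.
    rewrite lerDr; apply: Rintegral_ge0 => w _.
    by rewrite mulr_ge0 ?sqr_ge0.
  have bAB : bmeas (\1_(A `&` B) : T -> R).
    by apply: bounded_measurable_indic; exact: sub_sigma_algebra.
  rewrite -Rintegral_indicator// -bounded_RintegralZ//; apply: le_bounded_Rintegral.
  - by apply: bounded_measurableM => //; exact: bounded_measurable_cst.
  - exact: sqr_bm.
  - move=> w; rewrite indicE; have [|_] := boolP (w \in _); last by rewrite mulr0 mul0r.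
    rewrite inE => -[_ Bw]; rewrite mulr1 mul1r -[leRHS]real_normK ?num_real//.
    by rewrite ler_sqr// nnegrE ltW.
have := IH r (A `\` B) rl qall rt0 GAD bZ.
set C := [set w | has _ l] => second_step.
have mC : measurable C.
  apply: mhas => //.
  have := order_path_min (rev_trans le_trans) rl.
  by apply: sub_all => r' r'r; exact: le_trans rt0.
have -> : [set w | (eps <= `|M r w - Z w|) || has (fun r0 => eps <= `|M r0 w - Z w|) l] = B `|` C.
  by apply/seteqP; split => w /= /orP.
have mB : measurable B by exact: GM GB.
have PAC : fine (P (A `&` (B `|` C))) <= fine (P (A `&` B)) + fine (P ((A `\` B) `&` C)).
  rewrite -fineD ?fin_num_measure//; last exact: measurableI.
  apply: fine_le.
  - by apply: fin_num_measure; apply: measurableI => //; exact: measurableU.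
  - by rewrite fin_numD !fin_num_measure//; exact: measurableI.
  - rewrite -measureU//; [|exact: measurableI|]; last first.
      by apply/seteqP; split => // w /= [[Aw Bw] [[_ nBw] _]].
    apply: le_measure; rewrite ?inE//.
    + by apply: measurableI => //; exact: measurableU.
    + by apply: measurableU => //; exact: measurableI.
    + move=> w [Aw BCw]; have [Bw|nBw] := pselect (B w); first by left.
      by right; split => //; case: BCw.
apply: le_trans (ler_wpM2l (sqr_ge0 _) PAC) _; rewrite mulrDr.
apply: le_trans (lerD first_step second_step) _.
rewrite -bounded_RintegralD; [|exact: sqr_bm|exact: sqr_bm].
apply: le_bounded_Rintegral; [|exact: sqr_bm|].
  by apply: bounded_measurableD; exact: sqr_bm.
move=> w; rewrite -mulrDl ler_wpM2r ?sqr_ge0// !indicE in_setD in_setI.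
by case: (w \in A); case: (w \in B); rewrite ?addr0 ?add0r.
Qed.

(** The second moments of [M s] are bounded and increase as [s] decreases; at a
    time [s0] nearly reaching their supremum, all later increments are small in
    mean square. *)
Lemma reversed_martingale_energy (r : R) : 0 < r -> exists2 s0, s0 <= t0 &
  forall q, q <= s0 -> \int[P]_w (\1_setT w * (M q w - M s0 w) ^+ 2) < r.
Proof.
move=> r0; pose e s := \int[P]_w (\1_setT w * (M s w - 0) ^+ 2).
pose E := [set e s | s in [set s | s <= t0]].
have supE : has_sup E.
  split; first by exists (e t0), t0 => //=.
  exists 1 => _ [s /= st0 <-].
  rewrite -[leRHS](_ : \int[P]_w (1 : R) = 1); last first.
    by rewrite Rintegral_cst// mul1r [X in fine X](probability_setT P).
  apply: le_bounded_Rintegral.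
  - apply: sqr_bm => //; [exact: bmG (bM st0)|exact: bounded_measurable_cst].
  - exact: bounded_measurable_cst.
  - move=> w; rewrite indicE in_setT mul1r subr0.
    by have /andP[? ?] := @M01 s w st0; rewrite expr_le1.
have [_ [s0 /= s0t0 <-] es0] := sup_adherent r0 supE.
exists s0 => // q qs0.
have GT : G s0 setT.
  by have [G0 GC _] := sG s0; rewrite -[setT]setD0; exact: GC.
have := reversed_martingale_pythagoras qs0 s0t0 GT (bounded_measurable_cst _ 0).
have e_sup : e q <= sup E.
  by apply: sup_upper_bound => //; exists q => //=; exact: le_trans s0t0.
rewrite -/(e q) -/(e s0) => e_split.
by move: e_sup es0; rewrite e_split; lra.
Qed.

(** The maximal inequality is applied to finite portions of the sequence, sorted
    because the times may come in any order; the exceptional sets increase to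
    [B]. *)
Lemma reversed_martingale_tail (u : nat -> R) (eps r : R) :
  (forall n, u n <= t0) -> u n @[n --> \oo] --> -oo -> 0 < eps -> 0 < r ->
  exists B s0 N, [/\ measurable B, (P B <= r%:E)%E &
    forall w n, ~ B w -> (N <= n)%N -> `|M (u n) w - M s0 w| < eps].
Proof.
move=> ut0 uoo eps0 r0.
have re0 : 0 < eps ^+ 2 * r by rewrite mulr_gt0 ?exprn_gt0.
have [s0 s0t0 Ms0] := reversed_martingale_energy re0.
have /cvgrNyPle/(_ s0)[N _ uN] := uoo.
pose l k := [seq u n | n <- iota N k].
pose B k := [set w | has (fun r => eps <= `|M r w - M s0 w|) (l k)].
have lt0 k : all (fun r => r <= t0) (l k) by apply/allP => _ /mapP[n _ ->].
have ls0 k : all (fun r => r <= s0) (l k).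
  by apply/allP => _ /mapP[n + ->]; rewrite mem_iota => /andP[/uN].
have bs0 : bmeas (M s0) by exact: bmG (bM s0t0).
have mB k : measurable (B k) by exact: mhas.
have PB k : (P (B k) <= r%:E)%E.
  have [q [qs0 ql]] : exists q, q <= s0 /\ all (>= q) (l k).
    elim: (l k) => [|a l' [q [qs0 ql]]]; first by exists s0.
    exists (Num.min a q); split; first by rewrite ge_min qs0 orbT.
    rewrite /= ge_min lexx/=; apply: sub_all ql => b.
    by rewrite /= ge_min => ->; rewrite orbT.
  have GT : G s0 setT.
    by have [G0 GC _] := sG s0; rewrite -[setT]setD0; exact: GC.
  have pl : path >=%R s0 (sort >=%R (l k)).
    rewrite path_min_sorted; first by apply: sort_sorted => a b; exact: le_total.
    by rewrite all_sort.
  have := @reversed_martingale_maximal eps q _ s0 setT (M s0) eps0 pl.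
  rewrite all_sort => /(_ ql s0t0 GT (bM s0t0)) /le_lt_trans/(_ (Ms0 _ qs0)).
  rewrite ltr_pM2l ?exprn_gt0// setTI.
  rewrite (_ : [set w | _] = B k); last first.
    by apply/seteqP; split => w /=; rewrite (eq_has_r (mem_sort _ _)).
  by move=> /ltW; rewrite -lee_fin fineK ?fin_num_measure.
exists (\bigcup_k B k), s0, N; split; first exact: bigcupT_measurable.
  have ndB : nondecreasing_seq B.
    move=> a b ab; apply/subsetPset => w /hasP[x /mapP[n + ->] xw].
    rewrite mem_iota => /andP[Nn nNa]; apply/hasP; exists (u n) => //.
    by apply/mapP; exists n => //; rewrite mem_iota Nn (leq_trans nNa)// leq_add2l.
  have PBoo : P (B k) @[k --> \oo] --> P (\bigcup_k B k).
    exact: nondecreasing_cvg_mu mB (bigcupT_measurable _ mB) ndB.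
  have <- := cvg_lim (@ereal_hausdorff R) PBoo; apply: lime_le.
    by apply/cvg_ex; exists (P (\bigcup_k B k)).
  by apply: nearW => k; exact: PB.
move=> w n nB Nn; rewrite ltNge; apply/negP => bad; apply: nB.
exists (n - N).+1 => //; apply/hasP; exists (u n) => //; apply/mapP; exists n => //.
by rewrite mem_iota Nn addnS ltnS subnKC // leqnn.
Qed.

(** The paths oscillating by 1/(k+1) infinitely often are confined to sets of
    arbitrarily small probability. *)
Lemma reversed_martingale_cvg (u : nat -> R) :
  (forall n, u n <= t0) -> u n @[n --> \oo] --> -oo ->
  {ae P, forall w, cvg (M (u n) w @[n --> \oo])}.
Proof.
move=> ut0 uoo.
pose osc k := [set w | forall N, exists n m, [/\ (N <= n)%N, (N <= m)%N &
  k.+1%:R^-1 <= `|M (u n) w - M (u m) w|]].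
have nosc k : P.-negligible (osc k).
  apply: negligible_small => r r0.
  have eps0 : 0 < k.+1%:R^-1 / 2 :> R by rewrite divr_gt0// invr_gt0.
  have [B [s0 [N [mB PB BN]]]] := reversed_martingale_tail ut0 uoo eps0 r0.
  exists B; split => // w /(_ N)[n [m [Nn Nm]]]; apply: contraPP => nBw.
  apply/negP; rewrite -ltNge.
  apply: (le_lt_trans (ler_distD (M s0 w) _ _)).
  by rewrite (splitr k.+1%:R^-1) ltrD ?BN// distrC BN.
apply: (negligibleS _ (negligible_bigcup nosc)) => w /= ncvg.
apply: contrapT => nw; apply: ncvg.
apply: cauchy_cvg; apply: cauchy_exP => r r0.
have [k] := ltr_add_invr r0; rewrite add0r => kr.
have /existsNP[N Nk] : ~ osc k w by move=> oscw; apply: nw; exists k.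
exists (M (u N) w); exists N => // n /= Nn.
rewrite /ball/= (lt_trans _ kr)// ltNge; apply/negP => bad; apply: Nk.
by exists N, n.
Qed.

(** The two sequences are interleaved into one, whose almost sure limit is common
    to both. This is what makes the limit independent of the sequence. *)
Lemma reversed_martingale_cvg2 (u v : nat -> R) :
  (forall n, u n <= t0) -> (forall n, v n <= t0) ->
  u n @[n --> \oo] --> -oo -> v n @[n --> \oo] --> -oo ->
  {ae P, forall w, exists l : R, M (u n) w @[n --> \oo] --> l /\
    M (v n) w @[n --> \oo] --> l}.
Proof.
move=> ut vt uoo voo; pose x n := if odd n then v n./2 else u n./2.
have xt n : x n <= t0 by rewrite /x; case: ifP.
have xoo : x n @[n --> \oo] --> -oo.
  apply/cvgrNyPle => A.
  have /cvgrNyPle/(_ A)[N _ uN] := uoo; have /cvgrNyPle/(_ A)[N' _ vN] := voo.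
  exists (maxn N N').*2 => // n /= nN.
  have {}nN : (maxn N N' <= n./2)%N by rewrite -(doubleK (maxn N N')) half_leq.
  move: nN; rewrite geq_max /x => /andP[Nn N'n].
  by case: ifP => _; [exact: vN|exact: uN].
have := reversed_martingale_cvg xt xoo; apply: filterS => w /cvg_ex[l xl].
have sub (k : nat -> nat) : (forall n, (n <= k n)%N) -> M (x (k n)) w @[n --> \oo] --> l.
  move=> kn; apply: (@cvg_comp _ _ _ k (fun n => M (x n) w) _ _ _ _ xl).
  move=> A [N _ NA]; exists N => // n /= Nn; apply: NA => /=; exact: leq_trans (kn n).
exists l; split.
- have := sub (fun n => n.*2); rewrite /x.
  under eq_fun do rewrite odd_double doubleK.
  by apply => n; rewrite -addnn leq_addl.
- have := sub (fun n => n.*2.+1); rewrite /x.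
  under eq_fun do rewrite /= odd_double uphalf_double.
  by apply => n; rewrite -addnn leqW// leq_addl.
Qed.

End reversed_martingale.

(** * Almost sure identities and sections *)

(** Unlike for sequences, the index runs over any countable type, such as the
    finite sequences that index cylinders. *)
Lemma ae_forall_countable d (T : measurableType d) (R : realType)
    (P : probability T R) (C : countType) (Q : C -> T -> Prop) :
  (forall c, {ae P, forall w, Q c w}) -> {ae P, forall w, forall c, Q c w}.
Proof.
move=> aeQ.
pose N n := if unpickle n is Some c then ~` [set w | Q c w] else set0.
have nN n : P.-negligible (N n).
  by rewrite /N; case: unpickle => [c|]; [exact: aeQ|exact: negligible_set0].
apply: (negligibleS _ (negligible_bigcup nN)) => w /= /existsNP[c nQ].
by exists (pickle c) => //; rewrite /N pickleK.
Qed.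

(** The nonnegative difference [g - F] has zero integral. *)
Lemma ae_eq_le_integral d (T : measurableType d) (R : realType)
    (P : probability T R) (F : T -> \bar R) (g : T -> R) :
  measurable_fun setT F -> (forall w, 0 <= F w)%E ->
  P.-integrable setT (EFin \o g) -> {ae P, forall w, (F w <= (g w)%:E)%E} ->
  (\int[P]_w F w = \int[P]_w (g w)%:E)%E -> {ae P, forall w, F w = (g w)%:E}.
Proof.
move=> mF F0 gi Fg intE.
have mg := measurable_int P gi.
have Fi : P.-integrable setT F.
  apply/integrableP; split => //; under eq_integral do rewrite gee0_abs//.
  by rewrite intE ltey_eq (integrable_fin_num measurableT gi).
have mgF : measurable_fun setT (fun w => (g w)%:E - F w)%E.
  exact: emeasurable_funB.
have : (\int[P]_w `| (g w)%:E - F w | = 0)%E.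
  transitivity (\int[P]_w ((g w)%:E - F w))%E.
    apply: ae_eq_integral => //; first exact: measurableT_comp.
    by apply: filterS Fg => w Fw _; rewrite /= gee0_abs// subre_ge0.
  by rewrite integralB//= intE subee// (integrable_fin_num measurableT gi).
move=> /(ae_eq_integral_abs P measurableT mgF) gF0.
apply: filterS2 Fg gF0 => w Fw /(_ I)/= /eqP; rewrite sube_eq//.
  by rewrite add0e => /eqP.
Qed.

Lemma integral_bounds01 d (T : measurableType d) (R : realType)
    (P : probability T R) (f : T -> R) : measurable_fun setT f ->
  (forall x, 0 <= f x <= 1) -> (0 <= \int[P]_x (f x)%:E <= 1)%E.
Proof.
move=> mf f01; apply/andP; split.
  by apply: integral_ge0 => x _; rewrite lee_fin; have /andP[] := f01 x.
apply: (@le_trans _ _ (\int[P]_x (1%R : R)%:E)%E); last first.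
  by rewrite integral_cst// mul1e [X in (X <= _)%E](probability_setT P).
apply: ge0_le_integral => //.
- by move=> x _; rewrite lee_fin; have /andP[] := f01 x.
- exact/measurable_EFinP.
- by move=> x _; rewrite lee_fin; have /andP[] := f01 x.
Qed.

Section sections.
Local Open Scope ereal_scope.
Context d1 d2 d3 (T1 : measurableType d1) (T2 : measurableType d2)
  (T3 : measurableType d3) (R : realType).
Variables (phi : T1 * T2 -> T3) (B : set T3).
Hypotheses (mphi : measurable_fun setT phi) (mB : measurable B).

Let mE : measurable (phi @^-1` B).
Proof. exact: measurable_preimageT. Qed.

Lemma measurable_section_event w : measurable [set x | B (phi (w, x))].
Proof.
rewrite -[X in measurable X]/([eta pair w] @^-1` (phi @^-1` B)) -xsectionE.
exact: measurable_xsection.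
Qed.

Lemma measurable_section (m2 : probability T2 R) :
  measurable_fun setT (fun w => m2 [set x | B (phi (w, x))]).
Proof.
rewrite (_ : (fun w => _) = m2 \o xsection (phi @^-1` B)).
  exact: measurable_fun_xsection.
by apply/funext => w /=; rewrite xsectionE.
Qed.

Lemma product_measure_section (m1 : probability T1 R) (m2 : probability T2 R) :
  (m1 \x m2) (phi @^-1` B) = \int[m1]_w m2 [set x | B (phi (w, x))].
Proof. by apply: eq_integral => w _ /=; rewrite xsectionE. Qed.

Lemma fubini_section (m1 : probability T1 R) (m2 : probability T2 R) :
  \int[m1]_w m2 [set x | B (phi (w, x))] = \int[m2]_x m1 [set w | B (phi (w, x))].
Proof.
rewrite -product_measure_section.
rewrite (product_measure_unique (m' := m1 \x^ m2))//; last first.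
  by move=> A C mA mC; exact: product_measure2E.
by apply: eq_integral => x _ /=; rewrite ysectionE.
Qed.

End sections.

(** * Pullback limits for a flow without exceptional null set *)

(** [past s] and [future s] stand for the sigma-algebras of the flow up to and
    from time [s]. The flow axioms hold for every [w], which keeps null sets out of
    the joint measurability statements. *)
Section perfect_flow.
Context {R : realType} {d : measure_display} {Omega : measurableType d}.
Variable P : probability Omega R.
Context {X : completeMetricType R}.
Hypothesis sepX : separable X.
Variable S : R -> R -> Omega -> X -> X.
Variables past future : R -> set (set Omega).
Hypothesis S_comp : forall w s r t x, s <= r -> r <= t ->
  S t r w (S r s w x) = S t s w x.
Hypothesis S_cont : forall w s t, s <= t -> continuous (S t s w).
Hypothesis s_past : forall s, sigma_algebra setT (past s).
Hypothesis s_future : forall s, sigma_algebra setT (future s).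
Hypothesis past_sub : forall s, past s `<=` measurable.
Hypothesis future_sub : forall s, future s `<=` measurable.
Hypothesis future_anti : forall r s, r <= s -> future s `<=` future r.
Hypothesis S_future : forall s t u x, s <= t -> t <= u ->
  measurable_fun [set: g_sigma_algebraType (future s)]
    (fun w : g_sigma_algebraType (future s) => S u t w x : borel X).
Hypothesis S_past : forall s t u x, t <= u -> u <= s ->
  measurable_fun [set: g_sigma_algebraType (past s)]
    (fun w : g_sigma_algebraType (past s) => S u t w x : borel X).
Hypothesis past_future : forall s A B, future s A -> past s B ->
  (P (A `&` B) = P A * P B)%E.

Local Notation Fut s := (g_sigma_algebraType (future s)).
Local Notation Past s := (g_sigma_algebraType (past s)).

Lemma future_joint s t u : s <= t -> t <= u -> measurable_fun setT
  (fun p : Fut s * borel X => S u t p.1 p.2 : borel X).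
Proof.
move=> st tu; have [e dense_e] := separable_seq sepX.
apply: (caratheodory_measurable dense_e (T := Fut s)) => [x|w].
  exact: S_future.
exact: S_cont.
Qed.

Lemma past_joint s t u : t <= u -> u <= s -> measurable_fun setT
  (fun p : Past s * borel X => S u t p.1 p.2 : borel X).
Proof.
move=> tu us; have [e dense_e] := separable_seq sepX.
apply: (caratheodory_measurable dense_e (T := Past s)) => [x|w].
  exact: S_past.
exact: S_cont.
Qed.

Lemma measurable_id_past s : measurable_fun [set: Omega] (id : Omega -> Past s).
Proof.
move=> _ A mA; rewrite setTI preimage_id; apply: (@past_sub s).
by rewrite -[past s](sigma_algebra_id (s_past s)).
Qed.

Lemma measurable_id_future s : measurable_fun [set: Omega] (id : Omega -> Fut s).
Proof.
move=> _ A mA; rewrite setTI preimage_id; apply: (@future_sub s).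
by rewrite -[future s](sigma_algebra_id (s_future s)).
Qed.

Lemma flow_joint s t : s <= t -> measurable_fun setT
  (fun p : Omega * borel X => S t s p.1 p.2 : borel X).
Proof.
move=> st.
have mi : measurable_fun setT (fun p : Omega * borel X => (p.1 : Past t, p.2)).
  apply: measurable_fun_pair; last exact: measurable_snd.
  by apply: (measurableT_comp (@measurable_id_past t)); exact: measurable_fst.
exact: (measurableT_comp (past_joint st (lexx t)) mi).
Qed.

Lemma measurable_flow s t w : s <= t ->
  measurable_fun setT (S t s w : borel X -> borel X).
Proof. by move=> st; apply: continuous_measurable_borel_map; exact: S_cont. Qed.

Lemma past_future_integral s (h : Fut s * Past s -> \bar R) :
  measurable_fun setT h -> (forall z, 0 <= h z)%E ->
  (\int[P]_w h (w, w) = \int[P]_w \int[P]_w' h (w, w'))%E.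
Proof.
move=> mh h0; apply: (@independent_integral _ _ _ Omega (Fut s) (Past s) R P id id) => //.
- exact: measurable_id_future.
- exact: measurable_id_past.
- move=> A B mA mB; rewrite !preimage_id; apply: (@past_future s).
    by rewrite -[future s](sigma_algebra_id (s_future s)).
  by rewrite -[past s](sigma_algebra_id (s_past s)).
Qed.

Section evolution.
Variable rho : R -> probability (borel X) R.
Hypothesis rho_evolution : forall s t (B : set (borel X)), s <= t -> measurable B ->
  (\int[rho s]_x P [set w | B (S t s w x)] = rho t B)%E.

Definition mass (t : R) (B : set (borel X)) (s : R) (w : Omega) : R :=
  fine (rho s [set x | B (S t s w x)]).

Lemma measurable_mass_set t (B : set (borel X)) s w : s <= t -> measurable B ->
  measurable ([set x | B (S t s w x)] : set (borel X)).
Proof. by move=> st mB; apply: measurable_preimageT mB; exact: measurable_flow. Qed.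

Lemma mass_fineK t (B : set (borel X)) s w : s <= t -> measurable B ->
  ((mass t B s w)%:E = rho s [set x | B (S t s w x)])%E.
Proof.
by move=> st mB; rewrite fineK// fin_num_measure//; exact: measurable_mass_set.
Qed.

Lemma mass01 t (B : set (borel X)) s w : s <= t -> measurable B -> 0 <= mass t B s w <= 1.
Proof.
move=> st mB; rewrite -!lee_fin mass_fineK// measure_ge0/=.
by apply: probability_le1; exact: measurable_mass_set.
Qed.

Lemma mass_future t (B : set (borel X)) s : s <= t -> measurable B ->
  bounded_measurable (future s) (mass t B s).
Proof.
move=> st mB; split.
  apply: measurableT_comp (fine_measurable measurableT) _.
  exact: (measurable_section (future_joint (lexx s) st) mB).
by exists 1 => w; have /andP[? ?] := mass01 w st mB; rewrite ger0_norm.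
Qed.

Lemma mass_past t (B : set (borel X)) s : s <= t -> measurable B ->
  measurable_fun [set: Past t] (mass t B s : Past t -> R).
Proof.
move=> st mB; apply: measurableT_comp (fine_measurable measurableT) _.
exact: (measurable_section (past_joint st (lexx t)) mB).
Qed.

(** Write the flow from [r] to [t] as the flow from [s] to [t] after the flow from
    [r] to [s]. The former and the weight [W] belong to the future of [s], and the
    latter is independent of them; averaging over it turns [rho r] into [rho s]. *)
Lemma mass_martingale_ge0 t (B : set (borel X)) r s (W : Omega -> R) : r <= s -> s <= t ->
  measurable B -> measurable_fun [set: Fut s] (W : Fut s -> R) ->
  (forall w, 0 <= W w) ->
  (\int[P]_w (W w * mass t B r w)%:E = \int[P]_w (W w * mass t B s w)%:E)%E.
Proof.
move=> rs st mB mW W0; have rt := le_trans rs st.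
pose phi (q : (Fut s * Past s) * borel X) : borel X := S t s q.1.1 (S s r q.1.2 q.2).
have mphi : measurable_fun setT phi.
  have m1 : measurable_fun setT (fun q : (Fut s * Past s) * borel X =>
      (q.1.1, S s r q.1.2 q.2 : borel X)).
    apply: measurable_fun_pair.
      by apply: (measurableT_comp (@measurable_fst _ _ (Fut s) (Past s))); exact: measurable_fst.
    have m2 : measurable_fun setT (fun q : (Fut s * Past s) * borel X => (q.1.2, q.2)).
      apply: measurable_fun_pair; last exact: measurable_snd.
      by apply: (measurableT_comp (@measurable_snd _ _ (Fut s) (Past s))); exact: measurable_fst.
    exact: (measurableT_comp (past_joint rs (lexx s)) m2).
  exact: (measurableT_comp (future_joint (lexx s) st) m1).
pose h (z : Fut s * Past s) : \bar R := ((W z.1)%:E * rho r [set x | B (phi (z, x))])%E.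
have mh : measurable_fun setT h.
  apply: emeasurable_funM; last exact: measurable_section.
  by apply/measurable_EFinP; apply: (measurableT_comp mW); exact: measurable_fst.
have h0 z : (0 <= h z)%E by rewrite mule_ge0// lee_fin.
transitivity (\int[P]_w h (w, w))%E.
  apply: eq_integral => w _; rewrite EFinM mass_fineK// /h/= /phi/=.
  by congr (_ * rho r _)%E; apply/seteqP; split => x /=; rewrite S_comp.
rewrite past_future_integral//; apply: eq_integral => w _.
have mBS : measurable ([set x | B (S t s w x)] : set (borel X)) by exact: measurable_mass_set.
rewrite /h/= ge0_integralZl//; last 2 first.
- exact: (measurable_section (flow_joint rs) mBS).
- by rewrite lee_fin.
rewrite EFinM mass_fineK//; congr (_ * _)%E.
rewrite -(rho_evolution rs mBS).
exact: (fubini_section (flow_joint rs) mBS).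
Qed.

(** A bounded weight becomes nonnegative after adding a constant, and constants
    are themselves nonnegative weights. *)
Lemma mass_martingale t (B : set (borel X)) r s (W : Omega -> R) : r <= s -> s <= t ->
  measurable B -> bounded_measurable (future s) W ->
  \int[P]_w (W w * mass t B r w) = \int[P]_w (W w * mass t B s w).
Proof.
move=> rs st mB bW; have rt := le_trans rs st.
have bmO (u : R) (f : Omega -> R) : bounded_measurable (future u) f ->
    bounded_measurable (@measurable _ Omega) f.
  apply: bounded_measurableS; apply: subset_trans (@future_sub u) _.
  exact: sub_sigma_algebra.
have [_ [K WK]] := bW.
pose V w := W w + K.
have V0 w : 0 <= V w by rewrite -lerBlDr sub0r; have := WK w; rewrite ler_norml => /andP[].
have bK : bounded_measurable (future s) (fun=> K : R) by exact: bounded_measurable_cst.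
have bV : bounded_measurable (future s) V by exact: bounded_measurableD.
have bM u : u <= t -> bounded_measurable (@measurable _ Omega) (mass t B u).
  by move=> ut; exact: bmO (mass_future ut mB).
have eqge0 (V' : Omega -> R) : bounded_measurable (future s) V' -> (forall w, 0 <= V' w) ->
    \int[P]_w (V' w * mass t B r w) = \int[P]_w (V' w * mass t B s w).
  by move=> [mV' _] V'0; rewrite /Rintegral (mass_martingale_ge0 rs st mB mV' V'0).
have decomp u : u <= t -> \int[P]_w (W w * mass t B u w) =
    \int[P]_w (V w * mass t B u w) - \int[P]_w (K * mass t B u w).
  move=> ut; rewrite -bounded_RintegralB; last 2 first.
  - by apply: bounded_measurableM (bmO _ _ bV) (bM _ ut).
  - by apply: bounded_measurableM (bmO _ _ bK) (bM _ ut).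
  by apply: eq_Rintegral => w _; rewrite /V; ring.
have K0 : 0 <= K by exact: le_trans (WK point).
by rewrite !decomp// !eqge0.
Qed.

Lemma expectation_mass t (B : set (borel X)) s : s <= t -> measurable B ->
  (\int[P]_w (mass t B s w)%:E = rho t B)%E.
Proof.
move=> st mB; rewrite -(rho_evolution st mB) -(fubini_section (flow_joint st) mB).
by apply: eq_integral => w _; rewrite mass_fineK.
Qed.

Lemma mass_cvg2 t (B : set (borel X)) (u v : nat -> R) : measurable B ->
  (forall n, u n <= t) -> (forall n, v n <= t) ->
  u n @[n --> \oo] --> -oo -> v n @[n --> \oo] --> -oo ->
  {ae P, forall w, exists l : R, mass t B (u n) w @[n --> \oo] --> l /\
    mass t B (v n) w @[n --> \oo] --> l}.
Proof.
move=> mB; apply: (reversed_martingale_cvg2 (G := future)) => //.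
- by move=> s st; exact: mass_future.
- by move=> s w st; exact: mass01.
- by move=> r s W rs st bW; exact: mass_martingale.
Qed.

(** One fixed sequence of times, used to define the limit; the interleaving
    argument compares any other sequence with it. *)
Definition ref_time (t : R) (n : nat) : R := Num.min (- n%:R) t.

Lemma ref_time_le t n : ref_time t n <= t.
Proof. by rewrite /ref_time ge_min lexx orbT. Qed.

Lemma cvg_ref_time t : ref_time t n @[n --> \oo] --> -oo.
Proof.
apply/cvgrNyPle => A; exists (Num.truncn (- A)).+1 => // n /= An.
rewrite /ref_time ge_min lerNl; apply/orP; left.
by apply: le_trans (ltW (truncnS_gt _)) _; rewrite ler_nat.
Qed.

Section limit_masses.
Variable e : nat -> X.
Hypothesis dense_e : forall x (r : R), 0 < r -> exists n, mdist x (e n) < r.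
Variable t : R.
Local Notation cyl := (cylinder dense_e).

(** The superior limit is defined for every [w] and measurable with respect to the
    past, whereas the limit exists only almost surely. *)
Definition limsup_mass (w : Past t) (s : seq nat) : R :=
  fine (limn_esup (fun n => (mass t (cyl s) (ref_time t n) w)%:E)).

Lemma measurable_limsup_mass s : measurable_fun setT (limsup_mass ^~ s).
Proof.
apply: measurableT_comp (fine_measurable measurableT) _.
apply: (measurable_fun_limn_esup (f := fun n (w : Past t) =>
  (mass t (cyl s) (ref_time t n) w)%:E)) => n.
apply/measurable_EFinP; apply: mass_past; first exact: ref_time_le.
exact: measurable_cylinder.
Qed.

Lemma limsup_mass_ge0 w s : 0 <= limsup_mass w s.
Proof.
rewrite fine_ge0// limn_esup_lim; apply: lime_ge; first exact: is_cvg_esups.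
apply: nearW => n; apply: (@le_trans _ _ (mass t (cyl s) (ref_time t n) w)%:E).
  have /andP[] := mass01 w (ref_time_le t n) (measurable_cylinder dense_e s).
  by rewrite lee_fin.
by apply: ereal_sup_ubound; exists n => /=.
Qed.

Lemma limsup_mass_cvg w s (l : R) :
  mass t (cyl s) (ref_time t n) w @[n --> \oo] --> l -> limsup_mass w s = l.
Proof.
move=> ml; rewrite /limsup_mass.
have /cvg_limn_einf_sup[_ ->//] :
  (mass t (cyl s) (ref_time t n) w)%:E @[n --> \oo] --> l%:E.
by apply: cvg_EFin => //; exact: nearW.
Qed.

Lemma children_cvg (m : seq nat -> R) s : (forall s', 0 <= m s') ->
  (\sum_(i <oo) (m (i :: s))%:E)%E = (m s)%:E ->
  \sum_(i < n) m (nat_of_ord i :: s) @[n --> \oo] --> m s.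
Proof.
move=> m0 mE.
have : ((\sum_(0 <= i < n) (m (i :: s))%:E)%E @[n --> \oo] --> (m s)%:E).
  by rewrite -mE; apply: is_cvg_nneseries => i _ _; rewrite lee_fin.
under eq_fun do rewrite sumEFin big_mkord.
by move=> /fine_cvgP[].
Qed.

(** The event, belonging to the past, on which the limit masses come from a
    probability measure. *)
Definition proper_limit : set (Past t) :=
  [set w | limsup_mass w [::] = 1] `&`
  \bigcap_(s in setT) (
    [set w | (\sum_(i <oo) (limsup_mass w (i :: s))%:E)%E = (limsup_mass w s)%:E] `&`
    [set w | cyl s = set0 -> limsup_mass w s = 0]).

Lemma measurable_proper_limit : measurable proper_limit.
Proof.
have meq (f g : Past t -> \bar R) : measurable_fun setT f -> measurable_fun setT g ->
    measurable [set w | f w = g w].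
  by move=> mf mg; rewrite -[X in measurable X]setTI; exact: measurable_eqe.
have mlE s : measurable_fun setT (fun w => (limsup_mass w s)%:E).
  by apply/measurable_EFinP; exact: measurable_limsup_mass.
have cE s (c : R) : measurable [set w | limsup_mass w s = c].
  rewrite (_ : mkset _ = [set w | (limsup_mass w s)%:E = c%:E]).
    by apply: meq => //; exact: measurable_cst.
  by apply/seteqP; split => w /= => [->|[]].
apply: measurableI; first exact: cE.
rewrite -[X in measurable X]setCK setC_bigcap; apply: measurableC.
apply: countable_bigcupT_measurable => // s; apply: measurableC.
apply: measurableI.
  apply: meq => //; apply: ge0_emeasurable_sum => // k w _ _.
  by rewrite lee_fin limsup_mass_ge0.
have [cyl0|cyl0] := pselect (cyl s = set0).
  rewrite (_ : mkset _ = [set w | limsup_mass w s = 0]); first exact: cE.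
  by apply/seteqP; split => w /=; [exact|].
by rewrite (_ : mkset _ = setT)//; apply/seteqP; split => w //= _ /cyl0.
Qed.

Lemma cylinder_children s : cyl s = \bigcup_i cyl (i :: s).
Proof.
apply/seteqP; split => x /=; last by move=> [i _ [_]].
by rewrite /cylinder/= => <-; exists (center dense_e (size s) x) => //=; rewrite size_address.
Qed.

Lemma trivIset_children s : trivIset setT (fun i => cyl (i :: s)).
Proof.
by apply/trivIsetP => i j _ _ ij; apply/seteqP; split => // x [[xi _] [xj _]];
  move: ij; rewrite -xi -xj eqxx.
Qed.

Lemma law_children (m : probability (borel X) R) s :
  (\sum_(i <oo) m (cyl (i :: s)) = m (cyl s))%E.
Proof.
rewrite cylinder_children; apply/cvg_lim => //.
apply: (@measure_semi_sigma_additive _ (borel X) R m (fun i => cyl (i :: s))).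
- by move=> i; exact: measurable_cylinder.
- exact: trivIset_children.
- by apply: bigcupT_measurable => i; exact: measurable_cylinder.
Qed.

Lemma ae_mass_cvg (u : nat -> R) : (forall n, u n <= t) -> u n @[n --> \oo] --> -oo ->
  {ae P, forall w, forall s, mass t (cyl s) (u n) w @[n --> \oo] --> limsup_mass w s}.
Proof.
move=> ut uoo; apply: ae_forall_countable => s.
have := mass_cvg2 (measurable_cylinder dense_e s) ut (ref_time_le t) uoo (@cvg_ref_time t).
by apply: filterS => w [l [ul /limsup_mass_cvg ->]].
Qed.

Lemma measurable_limsup_mass_ambient s :
  measurable_fun [set: Omega] (limsup_mass ^~ s : Omega -> R).
Proof.
exact: (sub_measurable_fun (@past_sub t) (measurable_limsup_mass s)).
Qed.

Lemma expectation_limsup_mass s :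
  (\int[P]_w (limsup_mass w s)%:E = rho t (cyl s))%E.
Proof.
have mc := measurable_cylinder dense_e s.
have : (\int[P]_w (mass t (cyl s) (ref_time t n) w)%:E @[n --> \oo] -->
    \int[P]_w (limsup_mass w s)%:E)%E.
  apply: (@bounded_convergence _ _ _ _ _ _ 1) => [n||n w|].
  - have := mass_past (ref_time_le t n) mc.
    exact: (sub_measurable_fun (@past_sub t)).
  - exact: measurable_limsup_mass_ambient.
  - by have /andP[? ?] := mass01 w (ref_time_le t n) mc; rewrite ger0_norm.
  - have := ae_mass_cvg (ref_time_le t) (@cvg_ref_time t).
    by apply: filterS => w /(_ s).
rewrite (_ : (fun n => _) = cst (rho t (cyl s))); last first.
  by apply/funext => n; rewrite expectation_mass//; exact: ref_time_le.
move=> /cvg_lim <-//; exact: lim_cst.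
Qed.

Lemma sum_mass_le s u w n : u <= t ->
  \sum_(i < n) mass t (cyl (nat_of_ord i :: s)) u w <= mass t (cyl s) u w.
Proof.
move=> ut; have mc s' := measurable_cylinder dense_e s'.
pose m := image_law (rho u) (measurable_flow w ut).
have mE s' : (mass t (cyl s') u w)%:E = m (cyl s') by rewrite mass_fineK.
rewrite -lee_fin -sumEFin mE -law_children.
under eq_bigr do rewrite mE.
rewrite -(big_mkord xpredT (fun i => m (cyl (i :: s)))).
exact: nneseries_lim_ge.
Qed.

(** In the limit the masses of the children of a cylinder sum up to at most the
    mass of the cylinder, as finite sums pass to the limit. Both sides have the
    same expectation, [rho t] being a measure, so they agree almost surely: this
    is where escape of mass is excluded. *)
Lemma ae_proper_limit : {ae P, forall w : Omega, proper_limit w}.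
Proof.
have mc s := measurable_cylinder dense_e s.
have sums : {ae P, forall w : Omega, forall s,
    (\sum_(i <oo) (limsup_mass w (i :: s))%:E)%E = (limsup_mass w s)%:E}.
  apply: ae_forall_countable => s; apply: ae_eq_le_integral.
  - apply: ge0_emeasurable_sum => [k w _ _|k _]; first by rewrite lee_fin limsup_mass_ge0.
    by apply/measurable_EFinP; exact: measurable_limsup_mass_ambient.
  - by move=> w; apply: nneseries_ge0 => i _ _; rewrite lee_fin limsup_mass_ge0.
  - apply/integrableP; split.
      by apply/measurable_EFinP; exact: measurable_limsup_mass_ambient.
    rewrite (eq_integral (fun w : Omega => (limsup_mass w s)%:E)); last first.
      by move=> w _; rewrite /= ger0_norm ?limsup_mass_ge0.
    by rewrite expectation_limsup_mass ltey_eq fin_num_measure.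
  - have := ae_mass_cvg (ref_time_le t) (@cvg_ref_time t).
    apply: filterS => w wcvg; apply: lime_le.
      by apply: is_cvg_nneseries => i _ _; rewrite lee_fin limsup_mass_ge0.
    apply: nearW => n; rewrite sumEFin lee_fin big_mkord.
    have cvg_sum : \sum_(i < n) mass t (cyl (nat_of_ord i :: s)) (ref_time t k) w @[k --> \oo] -->
        \sum_(i < n) limsup_mass w (nat_of_ord i :: s).
      by apply: cvg_big => [|i _]; [exact: add_continuous|exact: wcvg].
    apply: ler_cvg_to cvg_sum (wcvg s) _; apply: nearW => k.
    by apply: sum_mass_le; exact: ref_time_le.
  - rewrite integral_nneseries//.
    + rewrite expectation_limsup_mass -law_children.
      by apply: eq_eseriesr => i _; rewrite expectation_limsup_mass.
    + by move=> i; apply/measurable_EFinP; exact: measurable_limsup_mass_ambient.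
    + by move=> i w _; rewrite lee_fin limsup_mass_ge0.
have := ae_mass_cvg (ref_time_le t) (@cvg_ref_time t).
move: sums; apply: filterS2 => w wsum wcvg.
have limE s (c : R) : (forall u, u <= t -> mass t (cyl s) u w = c) -> limsup_mass w s = c.
  move=> mc'; apply: limsup_mass_cvg; rewrite (_ : (fun _ => _) = cst c); first exact: cvg_cst.
  by apply/funext => n; rewrite mc'//; exact: ref_time_le.
split; first apply: limE => u ut.
  rewrite /mass (_ : [set x | _] = setT); last by apply/seteqP; split.
  by rewrite [X in fine X](probability_setT (rho u)).
move=> s _; split => //= cyl0; apply: limE => u ut.
by rewrite /mass cyl0 (_ : [set x | _] = set0)// measure0.
Qed.

(** Off the good event any consistent masses will do, provided that they are
    measurable: those of [rho t] are. *)
Definition limit_mass (w : Past t) (s : seq nat) : R :=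
  if w \in proper_limit then limsup_mass w s else fine (rho t (cyl s)).

Lemma measurable_limit_mass s : measurable_fun setT (limit_mass ^~ s).
Proof.
apply: measurable_fun_ifT; [|exact: measurable_limsup_mass|exact: measurable_cst].
apply: (measurable_fun_bool true); rewrite setTI.
rewrite (_ : _ @^-1` _ = proper_limit); first exact: measurable_proper_limit.
by apply/seteqP; split => w /= wP; [exact: set_mem|exact: mem_set].
Qed.

Lemma limit_mass_consistent w : consistent (limit_mass w).
Proof.
have [pw|npw] := boolP (w \in proper_limit).
  rewrite (_ : limit_mass w = limsup_mass w); last first.
    by apply/funext => s; rewrite /limit_mass pw.
  move: pw; rewrite inE => -[w1 wP]; split => // [s|s]; first exact: limsup_mass_ge0.
  by apply: children_cvg; [exact: limsup_mass_ge0|have [] := wP s I].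
have mc s := measurable_cylinder dense_e s.
rewrite (_ : limit_mass w = fun s => fine (rho t (cyl s))); last first.
  by apply/funext => s; rewrite /limit_mass (negbTE npw).
split => [s||s]; first by rewrite fine_ge0.
- rewrite (_ : cyl [::] = setT); last by apply/seteqP; split.
  by rewrite [X in fine X](probability_setT (rho t)).
- apply: (children_cvg (m := fun s => fine (rho t (cyl s)))); first by move=> s'; rewrite fine_ge0.
  rewrite fineK ?fin_num_measure// -law_children.
  by apply: eq_eseriesr => i _; rewrite fineK// fin_num_measure.
Qed.

Lemma limit_mass_empty w s : cyl s = set0 -> limit_mass w s = 0.
Proof.
move=> cyl0; rewrite /limit_mass; case: ifPn => [|_].
  by rewrite inE => -[_ wP]; have [_ /(_ cyl0)] := wP s I.
by rewrite cyl0 measure0.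
Qed.

Definition limit_law (w : Past t) : probability (borel X) R :=
  coded_law measurable_limit_mass limit_mass_consistent limit_mass_empty w.

(** A random point with conditional law [limit_law w] given [w]; it makes both the
    measurability of [limit_law] and the joint law on [Omega * X] immediate. *)
Definition limit_point (p : Past t * measurableTypeR R) : borel X :=
  coded e (limit_mass p.1) p.2.

Lemma measurable_limit_point : measurable_fun setT limit_point.
Proof.
exact: (measurable_coded measurable_limit_mass limit_mass_consistent limit_mass_empty).
Qed.

Lemma measurable_limit_law (B : set (borel X)) : measurable B ->
  measurable_fun setT (fun w : Past t => limit_law w B).
Proof. by move=> mB; exact: (measurable_section measurable_limit_point mB). Qed.

Lemma ae_weak_cvg_limit_law (u : nat -> R) (ut : forall n, u n <= t) :
  u n @[n --> \oo] --> -oo ->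
  {ae P, forall w : Omega,
    weak_cvg (fun n => image_law (rho (u n)) (measurable_flow w (ut n))) (limit_law w)}.
Proof.
move=> uoo; have := ae_mass_cvg ut uoo; move: ae_proper_limit.
apply: (@filterS2 Omega) => w wP wcvg; apply: coded_law_weak_cvg => s.
rewrite /limit_mass mem_set//.
rewrite (_ : (fun n => _) = fun n => (mass t (cyl s) (u n) w)%:E).
  by apply: cvg_EFin; [exact: nearW|exact: wcvg].
by apply/funext => n; rewrite mass_fineK//; exact: measurable_cylinder.
Qed.

Lemma measurable_limit_point_ambient : measurable_fun setT
  (fun p : Omega * measurableTypeR R => (limit_point (p.1 : Past t, p.2))).
Proof.
have mi : measurable_fun setT (fun p : Omega * measurableTypeR R => (p.1 : Past t, p.2)).
  apply: measurable_fun_pair; last exact: measurable_snd.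
  by apply: (measurableT_comp (@measurable_id_past t)); exact: measurable_fst.
exact: (measurableT_comp measurable_limit_point mi).
Qed.

Lemma measurable_limit_pair : measurable_fun setT
  (fun p : Omega * measurableTypeR R => (p.1, limit_point (p.1 : Past t, p.2))).
Proof.
by apply: measurable_fun_pair measurable_limit_point_ambient; exact: measurable_fst.
Qed.

Definition limit_joint : probability (Omega * borel X)%type R :=
  image_law (P \x @unit_interval_law R)%E measurable_limit_pair.

Lemma limit_jointE (C : set (Omega * borel X)) :
  (limit_joint C = \int[P]_w limit_law w [set x | C (w, x)])%E.
Proof.
exact: (product_measure_section (fun p : Omega * measurableTypeR R =>
  (p.1, limit_point (p.1 : Past t, p.2))) C P (@unit_interval_law R)).
Qed.

(** The means of the images of [rho s] all equal [rho t]. Integrals of a continuous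
    function pass to the limit by weak convergence, then under the expectation by
    bounded convergence; the mean of the limit laws is a measure, determined by
    these integrals. *)
Lemma expectation_limit_law (B : set (borel X)) : measurable B ->
  (\int[P]_w limit_law w B = rho t B)%E.
Proof.
move=> mB.
have mB2 : measurable [set p : Omega * borel X | B p.2].
  exact: measurable_preimageT (@measurable_snd _ _ Omega (borel X)) mB.
rewrite -[LHS](limit_jointE [set p : Omega * borel X | B p.2]).
pose mean := image_law limit_joint (@measurable_snd _ _ Omega (borel X)).
suff: mean B = rho t B by [].
apply: eq_measure_bounded_continuous mB => f cf f01.
have mf : measurable_fun setT (EFin \o f : borel X -> \bar R).
  by apply/measurable_EFinP; exact: continuous_measurable_borel.
have f0 x : (0 <= (f x)%:E)%E by rewrite lee_fin; have /andP[] := f01 x.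
pose u := ref_time t; have ut n : u n <= t by exact: ref_time_le.
pose nu n w := image_law (rho (u n)) (measurable_flow w (ut n)).
have nuE n : (\int[P]_w \int[nu n w]_x (f x)%:E = \int[rho t]_x (f x)%:E)%E.
  have mS := flow_joint (ut n).
  transitivity (\int[P \x rho (u n)]_p (f (S t (u n) p.1 p.2))%:E)%E.
    rewrite fubini_tonelli1//; last first.
      exact: (measurableT_comp mf mS).
    by apply: eq_integral => w _; rewrite ge0_integral_image_law.
  rewrite -(ge0_integral_image_law (P \x rho (u n))%E mS mf f0).
  apply: eq_measure_integral => A mA _.
  rewrite [LHS](product_measure_section _ A P (rho (u n))).
  by rewrite (fubini_section mS mA) rho_evolution.
have limE : (\int[P]_w \int[limit_law w]_x (f x)%:E = \int[mean]_x (f x)%:E)%E.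
  have mf2 := measurableT_comp mf (@measurable_snd _ _ Omega (borel X)).
  have push := ge0_integral_image_law (P \x @unit_interval_law R)%E
    measurable_limit_pair mf2 (fun p => f0 p.2).
  have snd_law := ge0_integral_image_law limit_joint (@measurable_snd _ _ Omega (borel X)) mf f0.
  symmetry; apply: etrans snd_law (etrans push _).
  have f_law w : (\int[limit_law w]_x (f x)%:E =
      \int[@unit_interval_law R]_u (f (limit_point (w, u)))%:E)%E.
    exact: ge0_integral_image_law mf f0.
  under [RHS]eq_integral do rewrite f_law.
  exact: (fubini_tonelli1 (m1 := P) (m2 := @unit_interval_law R)
    (fun p => (f (limit_point (p.1 : Past t, p.2)))%:E)
    (measurableT_comp mf measurable_limit_point_ambient) (fun p => f0 _)).
rewrite -limE.
have fin (m : probability (borel X) R) : (\int[m]_x (f x)%:E)%E \is a fin_num.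
  have /andP[I0 I1] := integral_bounds01 m (continuous_measurable_borel cf) f01.
  by rewrite ge0_fin_numE// (le_lt_trans I1)// ltry.
have bnd (m : probability (borel X) R) : `|fine (\int[m]_x (f x)%:E)%E| <= 1.
  have /andP[I0 I1] := integral_bounds01 m (continuous_measurable_borel cf) f01.
  by rewrite ger0_norm ?fine_ge0// -lee_fin fineK.
have nu_limit : (\int[P]_w (fine (\int[nu n w]_x (f x)%:E))%:E @[n --> \oo] -->
    \int[P]_w (fine (\int[limit_law w]_x (f x)%:E))%:E)%E.
  apply: (@bounded_convergence _ _ _ _ _ _ 1) => [n||n w|] //.
  - apply: measurableT_comp (fine_measurable measurableT) _.
    rewrite (_ : (fun w => _) = fubini_F (rho (u n)) (fun p => (f (S t (u n) p.1 p.2))%:E)).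
      apply: measurable_fun_fubini_tonelli_F => //.
      exact: (measurableT_comp mf (flow_joint (ut n))).
    by apply/funext => w; rewrite ge0_integral_image_law.
  - apply: measurableT_comp (fine_measurable measurableT) _.
    rewrite (_ : (fun w => _) = fubini_F (@unit_interval_law R)
        (fun p : Omega * measurableTypeR R => (f (limit_point (p.1 : Past t, p.2)))%:E)).
      apply: measurable_fun_fubini_tonelli_F => //.
      exact: (measurableT_comp mf measurable_limit_point_ambient).
    by apply/funext => w; rewrite ge0_integral_image_law.
  - apply: filterS (ae_weak_cvg_limit_law ut (@cvg_ref_time t)) => w wlim.
    have /wlim : exists M : R, forall x, `|f x| <= M.
      by exists 1 => x; have /andP[? ?] := f01 x; rewrite ger0_norm.
    by move=> /(_ cf); rewrite -(fineK (fin (limit_law w))) => /fine_cvgP[].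
have nu_const n : (\int[P]_w (fine (\int[nu n w]_x (f x)%:E))%:E = \int[rho t]_x (f x)%:E)%E.
  by rewrite -(nuE n); apply: eq_integral => w _; rewrite fineK.
have -> : (\int[P]_w \int[limit_law w]_x (f x)%:E =
    \int[P]_w (fine (\int[limit_law w]_x (f x)%:E))%:E)%E.
  by apply: eq_integral => w _; rewrite fineK.
rewrite -(cvg_lim (@ereal_hausdorff R) nu_limit).
rewrite (_ : (fun n => _) = cst (\int[rho t]_x (f x)%:E)%E) ?lim_cst//.
exact/funext.
Qed.

End limit_masses.

(** Push the convergence at time [s] forward by the continuous map from [s] to [t]:
    by the cocycle identity the same sequence of laws, the images of
    [rho (ref_time s n)] at time [t], converges weakly to both sides. *)
Lemma limit_law_flow (e : nat -> X)
    (dense_e : forall x (r : R), 0 < r -> exists n, mdist x (e n) < r) s t : s <= t ->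
  {ae P, forall w : Omega, forall B : set (borel X), measurable B ->
    limit_law dense_e (w : Past s) [set x | B (S t s w x)] =
    limit_law dense_e (w : Past t) B}.
Proof.
move=> st; have us n := ref_time_le s n; have ut n := le_trans (us n) st.
have := ae_weak_cvg_limit_law dense_e ut (@cvg_ref_time s).
have := ae_weak_cvg_limit_law dense_e us (@cvg_ref_time s).
apply: (@filterS2 Omega) => w cvg_s cvg_t B mB.
pose img := image_law (limit_law dense_e (w : Past s)) (measurable_flow w st).
suff: img B = limit_law dense_e (w : Past t) B by [].
apply: eq_measure_bounded_continuous mB => f cf f01.
have bf : exists M : R, forall x, `|f x| <= M.
  by exists 1 => x; have /andP[? ?] := f01 x; rewrite ger0_norm.
have cfS : continuous (f \o S t s w).
  by move=> x; apply: continuous_comp; [exact: S_cont|exact: cf].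
have bfS : exists M : R, forall x, `|(f \o S t s w) x| <= M.
  by have [M fM] := bf; exists M => x; exact: fM.
have f0 (x : borel X) : (0 <= (f x)%:E)%E by rewrite lee_fin; have /andP[] := f01 x.
have mf : measurable_fun setT (fun x : borel X => (f x)%:E).
  by apply/measurable_EFinP; exact: continuous_measurable_borel.
have mfS : measurable_fun setT (fun x : borel X => (f (S t s w x))%:E).
  exact: (measurableT_comp mf (measurable_flow w st)).
rewrite (ge0_integral_image_law _ (measurable_flow w st) mf f0).
apply: (cvg_unique (@ereal_hausdorff R) (cvg_s _ cfS bfS)).
rewrite (_ : (fun n => _) = (fun n =>
  (\int[image_law (rho (ref_time s n)) (measurable_flow w (ut n))]_x (f x)%:E)%E)).
  exact: cvg_t.
apply/funext => n.
rewrite (ge0_integral_image_law _ (measurable_flow w (us n)) mfS)//.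
rewrite (ge0_integral_image_law _ (measurable_flow w (ut n)) mf)//.
by apply: eq_integral => x _; rewrite S_comp.
Qed.

Lemma measurable_skew s t : s <= t -> measurable_fun setT
  (fun p : Omega * borel X => (p.1, S t s p.1 p.2 : borel X)).
Proof.
by move=> st; apply: measurable_fun_pair (flow_joint st); exact: measurable_fst.
Qed.

Theorem pullback_limit : exists (mu_ : R -> Omega -> probability (borel X) R)
    (mu : R -> probability (Omega * borel X)%type R),
  [/\ forall (t : R) (u : nat -> R), u n @[n --> \oo] --> -oo ->
        {ae P, forall w, weak_cvg
          (fun n => pushforward (rho (u n)) (S t (u n) w : borel X -> borel X)) (mu_ t w)},
      forall t, disintegration P (mu t) (mu_ t),
      forall s t (C : set (Omega * borel X)), s <= t -> measurable C ->
        mu s [set p : Omega * borel X | C (p.1, S t s p.1 p.2)] = mu t C,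
      forall t (B : set (borel X)), measurable B ->
        measurable_wrt (past t) (fun w => mu_ t w B) &
      forall t (B : set (borel X)), measurable B ->
        (\int[P]_w mu_ t w B)%E = rho t B].
Proof.
have [e dense_e] := separable_seq sepX.
exists (fun t w => limit_law dense_e (w : Past t)), (limit_joint dense_e); split.
- move=> t u uoo.
  (* the terms of the sequence above t are finitely many; cutting them down to t
     leaves the limit unchanged *)
  pose v n := Num.min (u n) t.
  have vt n : v n <= t by rewrite /v ge_min lexx orbT.
  have /cvgrNyPle/(_ t)[N _ uN] := uoo.
  have uv : \forall n \near \oo, v n = u n.
    by exists N => // n Nn; apply/min_idPl; exact: uN.
  have voo : v n @[n --> \oo] --> -oo.
    apply: cvg_trans uoo; apply: near_eq_cvg; apply: filterS uv => n; exact: esym.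
  have := ae_weak_cvg_limit_law dense_e vt voo.
  apply: filterS => w wcvg f cf bf; apply: cvg_trans (wcvg f cf bf).
  apply: near_eq_cvg; apply: filterS uv => n vu.
  by rewrite -vu.
- move=> t; split.
    move=> B mB; exact: (sub_measurable_fun (@past_sub t) (measurable_limit_law dense_e mB)).
  move=> A B mA mB; rewrite limit_jointE; apply: eq_integral => w _.
  rewrite indicE; have [wA|wA] := boolP (w \in A).
    rewrite mul1e; congr (limit_law _ _ _); apply/seteqP; split => x /=; first by case.
    by move=> Bx; split => //; exact: set_mem.
  rewrite mul0e (_ : [set x | _] = set0) ?measure0//.
  by apply/seteqP; split => // x [/= wA' _]; move/negP: wA; apply; exact: mem_set.
- move=> s t C st mC; rewrite !limit_jointE.
  have mC' : measurable [set p : Omega * borel X | C (p.1, S t s p.1 p.2)].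
    exact: measurable_preimageT (measurable_skew st) mC.
  apply: ae_eq_integral => //.
  + exact: (measurable_section (@measurable_limit_pair _ dense_e s) mC'
      (@unit_interval_law R)).
  + exact: (measurable_section (@measurable_limit_pair _ dense_e t) mC
      (@unit_interval_law R)).
  + apply: filterS (limit_law_flow dense_e st) => w eqw _.
    rewrite -eqw//.
    exact: (@measurable_section_event _ _ _ Omega (borel X) _ id C).
- move=> t B mB Y mY.
  rewrite -[past t](sigma_algebra_id (s_past t)).
  exact: (measurable_preimageT (measurable_limit_law dense_e mB) mY).
- by move=> t B mB; exact: expectation_limit_law.
Qed.

End evolution.

(** The flow from [s] to [t] depends on the future of [s] and the disintegration of
    [mu s] on the past, so the pair formed by the flow and a point drawn from
    [mu_ s] behaves as if the point were drawn from the mean [rho s],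
    independently of the flow. *)
Lemma mixing_evolution (mu : R -> probability (Omega * borel X)%type R)
    (mu_ : R -> Omega -> probability (borel X) R) (rho : R -> probability (borel X) R) :
  (forall t, disintegration P (mu t) (mu_ t)) ->
  (forall t (B : set (borel X)), measurable B ->
    measurable_fun [set: Past t] (fun w : Past t => mu_ t w B)) ->
  (forall t (B : set (borel X)), measurable B -> rho t B = (\int[P]_w mu_ t w B)%E) ->
  (forall s t (B : set (borel X)), s <= t -> measurable B ->
    mu s [set p : Omega * borel X | B (S t s p.1 p.2)] = mu t (setT `*` B)) ->
  forall s t (B : set (borel X)), s <= t -> measurable B ->
    (\int[rho s]_x P [set w | B (S t s w x)] = rho t B)%E.
Proof.
move=> mu_dis mu_past rhoE mu_ev s t B st mB.
have rho_mu u (A : set (borel X)) : measurable A -> (mu u (setT `*` A) = rho u A)%E.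
  move=> mA; have [_ ->//] := mu_dis u; rewrite rhoE//.
  by apply: eq_integral => w _; rewrite indicT mul1e.
have mid : measurable_fun setT (fun p : Omega * borel X => (p.1 : Fut s, p.2)).
  apply: measurable_fun_pair; last exact: measurable_snd.
  by apply: (measurableT_comp (@measurable_id_future s)); exact: measurable_fst.
pose P_fut := image_law P (@measurable_id_future s).
pose mu_fut := image_law (mu s) mid.
(* it suffices to know mu s on events of the form future times Borel, where
   independence makes it a product *)
have prodE (C : set (Fut s * borel X)) : measurable C -> ((P_fut \x rho s) C = mu_fut C)%E.
  apply: product_measure_unique => A D mA mD.
  have mAO : measurable (A : set Omega).
    by have := measurable_preimageT (@measurable_id_future s) mA.
  have [mD_ dis] := mu_dis s.
  rewrite -[LHS]/(mu s (A `*` D)) dis//.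
  pose h (z : Fut s * Past s) : \bar R := ((\1_A z.1)%:E * mu_ s z.2 D)%E.
  have mh : measurable_fun setT h.
    apply: emeasurable_funM.
      apply/measurable_EFinP.
      by apply: (measurableT_comp (measurable_indic mA)); exact: measurable_fst.
    by apply: (measurableT_comp (mu_past s D mD)); exact: measurable_snd.
  have h0 z : (0 <= h z)%E by rewrite mule_ge0// lee_fin.
  rewrite [LHS](past_future_integral mh h0).
  transitivity (\int[P]_w ((\1_A w)%:E * rho s D))%E.
    apply: eq_integral => w _; rewrite /h /= ge0_integralZl//; last exact: mD_.
    by rewrite rhoE.
  rewrite ge0_integralZr//; last by apply/measurable_EFinP; exact: measurable_indic.
  by rewrite integral_indic// setIT.
have mB' := future_joint (lexx s) st.
rewrite -rho_mu// -(mu_ev _ _ _ st mB).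
rewrite -[RHS]/(mu_fut [set p | B (S t s p.1 p.2)]) -prodE; last exact: measurable_preimageT mB' mB.
rewrite [RHS](product_measure_section (fun p : Fut s * borel X => S t s p.1 p.2 : borel X)).
by rewrite (fubini_section mB' mB).
Qed.

End perfect_flow.

(** * Removing the exceptional null set *)

Lemma null_modification d (T : measurableType d) (R : realType)
    (m : {measure set T -> \bar R}) (A A' N : set T) :
  measurable A -> measurable A' -> measurable N -> m N = 0%E ->
  A `+` A' `<=` N -> m A = m A'.
Proof.
move=> mA mA' mN N0 AA'.
have null B : measurable B -> m B = m (B `\` N).
  move=> mB; rewrite (measureDI m mB mN) [X in (_ + X)%E](_ : _ = 0%E) ?adde0//.
  by apply: (subset_measure0 _ mN) => //; exact: measurableI.
rewrite (null A)// (null A')//; congr (m _).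
have sub (B C : set T) : B `\` C `<=` N -> B `\` N `<=` C `\` N.
  by move=> BCN w [Bw nNw]; split => //; apply: contrapT => nCw; apply: nNw; exact: BCN.
by apply/seteqP; split; apply: sub; apply: subset_trans AA'; rewrite setY_def;
  [exact: subsetUl|exact: subsetUr].
Qed.

(** The set [A'] may fail to be measurable: this gives its measure in the
    completion of [m]. *)
Lemma outer_null_modification d (T : measurableType d) (R : realType)
    (m : {measure set T -> \bar R}) (A A' N : set T) :
  measurable A -> measurable N -> m N = 0%E ->
  A `+` A' `<=` N -> (m^*)%mu A' = m A.
Proof.
move=> mA mN N0 AA'.
have sub (B C : set T) : B `\` C `<=` N -> ((m^*)%mu B <= (m^*)%mu C)%E.
  move=> BCN; apply: (@le_trans _ _ ((m^*)%mu (C `|` N))).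
    apply: le_mu_ext => w Bw; have [Cw|nCw] := pselect (C w); first by left.
    by right; apply: BCN.
  apply: le_trans (outer_measureU2 (m^*)%mu _ _) _.
  by rewrite [X in (_ + X <= _)%E]measurable_mu_extE// N0 adde0.
rewrite -(measurable_mu_extE m mA); apply/eqP; rewrite eq_le; apply/andP; split;
  apply: sub; apply: subset_trans AA'; rewrite setY_def.
- exact: subsetUr.
- exact: subsetUl.
Qed.

(** The flow is replaced by the identity on the null set where its axioms fail.
    This changes events by null sets only, hence keeps them in the completed
    sigma-algebras. *)
Section perfection.
Context {R : realType} {d : measure_display} {Omega : measurableType d}.
Variable P : probability Omega R.
Context {X : completeMetricType R}.
Variable S : R -> R -> Omega -> X -> X.

Lemma completionS (G H : set (set Omega)) : G `<=` H -> completion P G `<=` completion P H.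
Proof. by move=> GH A [B GB nAB]; exists B => //; exact: GH. Qed.

Hypothesis S_measurable : forall (t : R) (x : X),
  measurable_fun (`]-oo, t] `*` [set: Omega] : set (R * Omega))
    (fun p : R * Omega => S t p.1 p.2 x : borel X).

Lemma measurable_flow_event s t x (B : set (borel X)) : s <= t -> measurable B ->
  measurable [set w | B (S t s w x)].
Proof.
move=> st mB.
have mD : measurable (`]-oo, t] `*` [set: Omega] : set (R * Omega)).
  by apply: measurableX => //; exact: measurable_itv.
have := @S_measurable t x mD B mB.
have mi : measurable_fun setT (fun w : Omega => (s, w)) by exact: measurable_fun_pair.
move=> /(measurable_preimageT mi); congr measurable; apply/seteqP; split => w /=.
  by move=> [_].
by move=> Bw; split => //; split => //=; rewrite in_itv.
Qed.

Definition events_of (I : R -> R -> Prop) : set (set Omega) :=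
  [set A | exists u t (x : X) (B : set (borel X)),
    [/\ t <= u, I u t, measurable B & A = (fun w => S u t w x) @^-1` B]].

(** The completed sigma-algebra generated by the flow over the time intervals
    selected by [I], restricted to measurable sets: the completion may contain
    non-measurable sets, and [P] is a measure only on the measurable ones. *)
Definition saturated (I : R -> R -> Prop) : set (set Omega) :=
  completion P <<s events_of I >> `&` measurable.

Lemma saturated_sigma_algebra I : sigma_algebra setT (saturated I).
Proof.
apply: sigma_algebraI; apply: sigma_algebra_completion.
  exact: smallest_sigma_algebra.
apply: smallest_sub; first exact: sigma_algebra_measurable.
by move=> _ [u [t [x [B [tu _ mB ->]]]]]; exact: measurable_flow_event.
Qed.

Lemma saturatedS (I J : R -> R -> Prop) : (forall u t, I u t -> J u t) ->
  saturated I `<=` saturated J.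
Proof.
move=> IJ A [cA mA]; split => //; apply: completionS cA.
apply: sub_smallest2r; first exact: smallest_sigma_algebra.
move=> _ [u [t [x [B [tu Iut mB ->]]]]].
by exists u, t, x, B; split => //; exact: IJ.
Qed.

Variable N : set Omega.
Hypotheses (mN : measurable N) (N0 : P N = 0%E).

Definition perfect_flow_of (t s : R) (w : Omega) (x : X) : X :=
  if w \in N then x else S t s w x.

Lemma perfect_flow_event_diff s t x (B : set X) :
  [set w | B (perfect_flow_of t s w x)] `+` [set w | B (S t s w x)] `<=` N.
Proof.
by move=> w; apply: contraPP => nNw; rewrite setY_def /perfect_flow_of /= memNset// => -[[]|[]].
Qed.

Lemma measurable_perfect_flow_event s t x (B : set (borel X)) : s <= t -> measurable B ->
  measurable [set w | B (perfect_flow_of t s w x)].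
Proof.
move=> st mB.
rewrite (_ : [set w | _] = ([set w | B (S t s w x)] `\` N) `|` (N `&` [set _ | B x])).
  apply: measurableU; first by apply: measurableD => //; exact: measurable_flow_event.
  apply: measurableI => //; have [Bx|nBx] := pselect (B x).
    by rewrite (_ : mkset _ = setT)//; apply/seteqP; split.
  by rewrite (_ : mkset _ = set0)//; apply/seteqP; split.
apply/seteqP; split => w; rewrite /perfect_flow_of /=.
  case: ifPn => [/set_mem Nw|/negP nNw] Bw; first by right.
  by left; split => // Nw; apply: nNw; exact: mem_set.
by move=> [[Bw nNw]|[Nw Bx]]; [rewrite memNset|rewrite mem_set].
Qed.

Lemma perfect_flow_eventE s t x (B : set (borel X)) : s <= t -> measurable B ->
  P [set w | B (perfect_flow_of t s w x)] = P [set w | B (S t s w x)].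
Proof.
move=> st mB; apply: (null_modification _ _ mN N0).
- exact: measurable_perfect_flow_event.
- exact: measurable_flow_event.
- exact: perfect_flow_event_diff.
Qed.

Lemma saturated_perfect_flow (I : R -> R -> Prop) u t x : t <= u -> I u t ->
  measurable_fun [set: g_sigma_algebraType (saturated I)]
    (fun w : g_sigma_algebraType (saturated I) => perfect_flow_of u t w x : borel X).
Proof.
move=> tu Iut _ B mB; rewrite setTI; apply: sub_sigma_algebra; split.
  exists [set w | B (S u t w x)].
    by apply: sub_sigma_algebra; exists u, t, x, B; split.
  by exists N; split => //; exact: perfect_flow_event_diff.
exact: measurable_perfect_flow_event.
Qed.

End perfection.

(** * The white noise flow *)

Section white_noise.
Context {R : realType} {d : measure_display} {Omega : measurableType d}.
Variable P : probability Omega R.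
Context {X : completeMetricType R}.
Variable S : R -> R -> Omega -> X -> X.

Definition past_events (s : R) : set (set Omega) := saturated P S (fun u _ => u <= s).
Definition future_events (s : R) : set (set Omega) := saturated P S (fun _ t => s <= t).

Lemma past_eventsE s : past_events s = sigma_le P S s `&` measurable.
Proof. by []. Qed.

Lemma future_eventsE s : future_events s = sigma_ge P S s `&` measurable.
Proof.
rewrite /future_events /saturated /sigma_ge; congr (completion P <<s _ >> `&` _).
by apply/seteqP; split => A [u [t [x [B [tu us mB AE]]]]]; exists u, t, x, B.
Qed.

Hypothesis indepS : forall s, independent_sigma P (sigma_ge P S s) (sigma_le P S s).

Lemma future_past_independent s A B : future_events s A -> past_events s B ->
  (P (A `&` B) = P A * P B)%E.
Proof.
rewrite future_eventsE past_eventsE => -[GA mA] [LB mB].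
have := indepS GA LB; rewrite !measurable_mu_extE//.
exact: measurableI.
Qed.

End white_noise.

Theorem theorem3p7 (R : realType) (d : measure_display)
    (Omega : measurableType d) (P : probability Omega R)
    (X : completeMetricType R) (sepX : separable X)
    (S : R -> R -> Omega -> X -> X) (flowS : white_noise_flow P S) :
  (forall rho : R -> probability (borel X) R,
    evolution_system_semigroup P S rho ->
    exists (mu_ : R -> Omega -> probability (borel X) R)
           (mu : R -> probability (Omega * borel X)%type R),
      [/\ forall (t : R) (s : nat -> R), s n @[n --> \oo] --> -oo ->
            {ae P, forall w,
              weak_cvg (fun n => pushforward (rho (s n))
                         (S t (s n) w : borel X -> borel X)) (mu_ t w)},
          (forall t, disintegration P (mu t) (mu_ t)) /\
            evolution_system_flow P S mu,
          forall t (B : set (borel X)), measurable B ->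
            measurable_wrt (sigma_le P S t) (fun w => mu_ t w B) &
          forall t (B : set (borel X)), measurable B ->
            (\int[P]_w mu_ t w B)%E = rho t B]) /\
  (forall (mu : R -> probability (Omega * borel X)%type R)
          (mu_ : R -> Omega -> probability (borel X) R),
    evolution_system_flow P S mu ->
    (forall t, disintegration P (mu t) (mu_ t)) ->
    (forall t (B : set (borel X)), measurable B ->
      measurable_wrt (sigma_le P S t) (fun w => mu_ t w B)) ->
    exists2 rho : R -> probability (borel X) R,
      (forall t (B : set (borel X)), measurable B ->
        rho t B = (\int[P]_w mu_ t w B)%E) &
      evolution_system_semigroup P S rho).
Proof.
have [[[N [mN N0 goodN]] mS] indepS] := flowS.
have good w : ~ N w -> [/\ forall s r t, s <= r -> r <= t -> S t r w \o S r s w = S t s w,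
    forall s t, s <= t -> continuous (S t s w) & forall t, S t t w = id].
  by move=> nNw; apply: contrapT => bad; apply: nNw; exact: goodN.
pose S' := perfect_flow_of S N.
have S'E w : ~ N w -> forall t s, S' t s w = S t s w.
  by move=> nNw t s; apply/funext => x; rewrite /S' /perfect_flow_of memNset.
have S'N w : N w -> forall t s, S' t s w = id.
  by move=> Nw t s; apply/funext => x; rewrite /S' /perfect_flow_of mem_set.
pose past := past_events P S; pose future := future_events P S.
have S'_comp w s r t x : s <= r -> r <= t -> S' t r w (S' r s w x) = S' t s w x.
  move=> sr rt; have [Nw|nNw] := pselect (N w); first by rewrite !S'N.
  by rewrite !S'E//; have [comp _ _] := good _ nNw; rewrite -(comp _ _ _ sr rt).
have S'_cont w s t : s <= t -> continuous (S' t s w).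
  move=> st; have [Nw|nNw] := pselect (N w); first by rewrite S'N//; move=> x; exact: cvg_id.
  by rewrite S'E//; have [_ cont _] := good _ nNw; exact: cont.
have s_past s : sigma_algebra setT (past s) by exact: saturated_sigma_algebra.
have s_future s : sigma_algebra setT (future s) by exact: saturated_sigma_algebra.
have past_sub s : past s `<=` measurable by move=> A [].
have future_sub s : future s `<=` measurable by move=> A [].
have future_anti r s : r <= s -> future s `<=` future r.
  by move=> rs; apply: saturatedS => _ t; exact: le_trans.
have S'_future s t u x : s <= t -> t <= u ->
    measurable_fun [set: g_sigma_algebraType (future s)]
      (fun w : g_sigma_algebraType (future s) => S' u t w x : borel X).
  by move=> st tu; exact: saturated_perfect_flow.
have S'_past s t u x : t <= u -> u <= s ->
    measurable_fun [set: g_sigma_algebraType (past s)]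
      (fun w : g_sigma_algebraType (past s) => S' u t w x : borel X).
  by move=> tu us; exact: saturated_perfect_flow.
have past_future s A B : future s A -> past s B -> (P (A `&` B) = P A * P B)%E.
  exact: future_past_independent.
have ev_rho rho : evolution_system_semigroup P S rho <->
    forall s t (B : set (borel X)), s <= t -> measurable B ->
    (\int[rho s]_x P [set w | B (S' t s w x)] = rho t B)%E.
  have trE s t (B : set (borel X)) x : s <= t -> measurable B ->
      transition P S s t \1_B x = P [set w | B (S' t s w x)].
    move=> st mB; rewrite (perfect_flow_eventE mS mN N0 x st mB).
    rewrite /transition unlock.
    have mE := measurable_flow_event mS x st mB.
    by rewrite -[in RHS](setIT [set w | _]) -integral_indic.
  split => ev s t.
    move=> B st mB; rewrite -(ev s t st B mB).
    by apply: eq_integral => x _; rewrite trE.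
  move=> st B mB; rewrite -(ev s t B st mB).
  by apply: eq_integral => x _; rewrite trE.
(* the skew products of the two flows differ inside N * X, which is null for mu s
   because its marginal is P *)
have skewE (mu : R -> probability (Omega * borel X)%type R) s t (C : set (Omega * borel X)) :
    s <= t -> marginal P (mu s) -> measurable C ->
    pushforward ((mu s)^*)%mu (Defs.skew S s t) C =
    mu s [set p : Omega * borel X | C (p.1, S' t s p.1 p.2)].
  move=> st marg mC; rewrite /pushforward.
  apply: (@outer_null_modification _ _ _ _ _ _ (N `*` setT)).
  - exact: measurable_preimageT (measurable_skew sepX S'_cont s_past past_sub S'_past st) mC.
  - exact: measurableX.
  - rewrite -N0 -(marg _ mN) /pushforward; congr (mu s _).
    by apply/seteqP; split => -[w x] //= [].
  - move=> [w x]; rewrite setY_def /Defs.skew /=; apply: contraPP => nNw.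
    have {}nNw : ~ N w by move=> Nw; apply: nNw.
    by rewrite /= S'E// => -[[]|[]].
split.
- move=> rho /ev_rho rho_ev.
  have [mu_ [mu [weak dis flow meas mean]]] := pullback_limit sepX S'_comp S'_cont s_past
    s_future past_sub future_sub future_anti S'_future S'_past past_future rho_ev.
  exists mu_, mu; split => //.
  + move=> t s soo.
    have aeN : {ae P, forall w, ~ N w} by exists N; split => // w /contrapT.
    move: aeN (weak t s soo); apply: (@filterS2 Omega) => w nNw.
    by congr (weak_cvg _ _); apply/funext => n; rewrite S'E.
  + have marg s : marginal P (mu s).
      move=> A mA; rewrite /pushforward (_ : fst @^-1` A = A `*` setT); last first.
        by apply/seteqP; split => -[w x] //= [].
      have [_ ->//] := dis s.
      under eq_integral do rewrite probability_setT mule1.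
      by rewrite integral_indic// setIT.
    split => //; split => // s t st C mC.
    by rewrite skewE// flow.
  + move=> t B mB Y mY; have := meas t B mB Y mY.
    by rewrite /past past_eventsE => -[].
- move=> mu mu_ [marg flow] dis meas.
  pose rho t := image_law (mu t) (@measurable_snd _ _ Omega (borel X)).
  have rhoE t (B : set (borel X)) : measurable B -> rho t B = (\int[P]_w mu_ t w B)%E.
    move=> mB; rewrite /rho image_lawE (_ : snd @^-1` B = setT `*` B); last first.
      by apply/seteqP; split => -[w x] //= [].
    have [_ ->//] := dis t.
    by apply: eq_integral => w _; rewrite indicT mul1e.
  exists rho => //; apply/ev_rho.
  apply: (mixing_evolution sepX S'_cont s_past s_future past_sub future_sub
    S'_future past_future dis).
  + move=> t B mB _ Y mY; rewrite setTI; apply: sub_sigma_algebra.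
    rewrite /past past_eventsE; split; first exact: meas.
    by have [mB_ _] := dis t; exact: measurable_preimageT (mB_ B mB) mY.
  + exact: rhoE.
  + move=> s t B st mB.
    have mTB : measurable ([set: Omega] `*` B) by exact: measurableX.
    rewrite -(flow s t st _ mTB) skewE//; congr (mu s _).
    by apply/seteqP; split => p //= [].
Qed.
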